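(* Let $k\geq 5$ and $h\geq 2$ be integers, and let $\mathcal{P}_{h}$ be the set of all $k$-polycyclic chains with $h$ $k$-polygons, i.e. the set of graphs isomorphic to $P(w)$ for some $w\in\{0,1,\dots,k-4\}^{h-2}$. Then for every $G\in\mathcal{P}_h$, $$Kf(G)\leq Kf\Big(P(\underbrace{\lfloor\tfrac{k-4}{2}\rfloor,\lceil\tfrac{k-4}{2}\rceil,\lfloor\tfrac{k-4}{2}\rfloor,\lceil\tfrac{k-4}{2}\rceil,\dots}_{h-2})\Big),$$ with equality if and only if $G\cong L_h$ when $k$ is even, and $G\cong Z_h$ when $k$ is odd. Here, for $k$ even, $L_h:=P(\frac{k-4}{2},\dots,\frac{k-4}{2})$ (the linear chain), and for $k$ odd, $Z_h:=P(\lfloor\frac{k-4}{2}\rfloor,\lceil\frac{k-4}{2}\rceil,\lfloor\frac{k-4}{2}\rfloor,\lceil\frac{k-4}{2}\rceil,\dots)$ (the zigzag chain, whose entries alternate; it is isomorphic to the chain with alternating entries starting with $\lceil\frac{k-4}{2}\rceil$).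
   Context: All graphs are simple and connected. Regard each edge of a graph $G$ as a unit resistor; the resistance distance $\Omega_G(u,v)$ is the effective resistance between $u$ and $v$ in the resulting electrical network. The Kirchhoff index is $Kf(G)=\sum_{\{u,v\}\subseteq V(G)}\Omega_G(u,v)$. $k$-polycyclic chains: Let $h\geq 2$. The linear quadrilateral chain $Q_h$ has vertices $t_0,\dots,t_h,s_0,\dots,s_h$ and edges $t_{j-1}t_j$, $s_{j-1}s_j$ ($1\leq j\leq h$) and $t_js_j$ ($0\leq j\leq h$); its $i$-th square $S_i$ ($1\le i\le h$) is the 4-cycle $t_{i-1}t_is_is_{i-1}$, with top edge $t_{i-1}t_i$ and bottom edge $s_{i-1}s_i$. For $w=(w_1,\dots,w_{h-2})$ with each $w_i\in\{0,1,\dots,k-4\}$, the $k$-polycyclic chain $P(w)=P_h(w)$ is obtained from $Q_h$ by: subdividing the top edges of $S_1$ and $S_h$ with $\lceil\frac{k-4}{2}\rceil$ new vertices each and the bottom edges of $S_1$ and $S_h$ with $\lfloor\frac{k-4}{2}\rfloor$ new vertices each; and, for $1\le i\le h-2$, subdividing the top edge of $S_{i+1}$ with $w_i$ new vertices and the bottom edge of $S_{i+1}$ with $k-4-w_i$ new vertices. Thus each square becomes a $k$-cycle and consecutive polygons share the edge $t_is_i$. *)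

(* Defs.v *)
From HB Require Import structures.
From mathcomp Require Import all_boot all_order all_algebra.

Set Implicit Arguments.
Unset Strict Implicit.
Unset Printing Implicit Defensive.

Import Order.TTheory GRing.Theory Num.Theory.
Local Open Scope ring_scope.

Record graph := Graph {
  vertex :> finType;
  adj : rel vertex;
  adj_sym : symmetric adj;
  adj_irr : irreflexive adj;
  adj_connected : forall x y, connect adj x y
}.

Definition isomorphic (G H : graph) : Prop :=
  exists2 f : G -> H, bijective f & forall x y, adj (f x) (f y) = adj x y.

Section Resistance.
Variables (R : realFieldType) (G : graph).

(* [laplacian phi x] is the net current flowing out of x under the potential
   phi when every edge is a unit resistor. The regular module R^o is only there
   to make {ffun G -> R} a vector space. *)
Definition laplacian (phi : {ffun G -> R^o}) : {ffun G -> R^o} :=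
  [ffun x => \sum_(y | adj x y) (phi x - phi y)].

Fact laplacian_is_linear : linear laplacian.
Proof.
move=> a f g; apply/ffunP=> x; rewrite !ffunE scaler_sumr -big_split /=.
apply: eq_bigr => y _; rewrite !ffunE scalerBr.
by rewrite opprD addrACA.
Qed.

HB.instance Definition _ :=
  GRing.isLinear.Build R {ffun G -> R^o} {ffun G -> R^o} *:%R laplacian
    laplacian_is_linear.

Definition unit_source (u v : G) : {ffun G -> R^o} :=
  [ffun x => (x == u)%:R - (x == v)%:R].

(* Kirchhoff's current law, with a unit current injected at u and extracted
   at v. *)
Definition unit_current_potential (u v : G) (phi : {ffun G -> R^o}) : Prop :=
  laplacian phi = unit_source u v.

(* The potential used here is one solution of Kirchhoff's equations, and the
   value does not depend on that choice: see resistance_potentialP and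
   resistanceE. *)
Definition resistance_potential (u v : G) : {ffun G -> R^o} :=
  ((linfun laplacian)^-1)%VF (unit_source u v).

Definition resistance (u v : G) : R :=
  resistance_potential u v u - resistance_potential u v v.

(* Comparing enumeration ranks counts each pair {u, v} exactly once. *)
Definition Kirchhoff : R :=
  \sum_(u : G) \sum_(v : G | (enum_rank u < enum_rank v)%N) resistance u v.

Lemma sum_laplacian (phi : {ffun G -> R^o}) : \sum_x laplacian phi x = 0.
Proof.
suff E : \sum_x laplacian phi x = - \sum_x laplacian phi x.
  by apply/eqP; rewrite -[_ == 0](mulrn_eq0 _ 2) mulr2n {1}E addNr.
under eq_bigr do rewrite ffunE big_mkcond /=.
rewrite {1}exchange_big /= -sumrN; apply: eq_bigr => x _.
rewrite -sumrN; apply: eq_bigr => y _.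
by rewrite adj_sym; case: ifP; rewrite ?oppr0 ?opprB.
Qed.

(* The Dirichlet energy argument. *)
Lemma laplacian_eq0 (phi : {ffun G -> R^o}) :
  laplacian phi = 0 -> forall x y, phi x = phi y.
Proof.
move=> phi0.
have E : \sum_x \sum_(y | adj x y) (phi x - phi y) ^+ 2 = 0 :> R.
  have E1 : \sum_x \sum_(y | adj x y) phi x * (phi x - phi y) = 0 :> R.
    apply: big1 => x _; rewrite -mulr_sumr.
    by move/ffunP/(_ x): phi0; rewrite !ffunE => ->; rewrite mulr0.
  have E2 : \sum_x \sum_(y | adj x y) phi y * (phi x - phi y) = 0 :> R.
    apply/eqP; rewrite -oppr_eq0 -[X in _ == X]E1; apply/eqP.
    under eq_bigr do rewrite big_mkcond /=.
    rewrite exchange_big /= -sumrN; apply: eq_bigr => x _.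
    rewrite -sumrN [RHS]big_mkcond /=; apply: eq_bigr => y _.
    by rewrite adj_sym; case: ifP; rewrite ?oppr0 // -mulrN opprB.
  move: (congr2 (fun a b : R => a - b) E1 E2); rewrite subr0; apply: etrans.
  rewrite -sumrB; apply: eq_bigr => x _.
  by rewrite -sumrB; apply: eq_bigr => y _; rewrite -mulrBl expr2.
have step x y : adj x y -> phi x = phi y.
  move=> xy; apply/eqP; rewrite -subr_eq0 -sqrf_eq0.
  have /psumr_eq0P/(_ E x isT) : forall x : G, true ->
      0 <= \sum_(y | adj x y) (phi x - phi y) ^+ 2.
    by move=> z _; apply: sumr_ge0 => t _; apply: sqr_ge0.
  move/psumr_eq0P => E'; rewrite E' // => z _; exact: sqr_ge0.
move=> x y; have /connectP[p xp ->] := adj_connected x y.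
elim: p x xp => //= z p IHp x /andP[xz zp]; rewrite (step _ _ xz); exact: IHp.
Qed.

Lemma resistance_potentialP u v :
  unit_current_potential u v (resistance_potential u v).
Proof.
rewrite /unit_current_potential /resistance_potential.
pose L := linfun laplacian.
pose total (f : {ffun G -> R^o}) : R^o := \sum_x f x.
have total_lin : linear total.
  move=> a f g; rewrite /total scaler_sumr -big_split /=.
  by apply: eq_bigr => x _; rewrite !ffunE.
pose totalL := GRing.isLinear.Build R {ffun G -> R^o} R^o *:%R total total_lin.
pose totl : {linear {ffun G -> R^o} -> R^o} := HB.pack total totalL.
pose S := linfun totl.
have LE f : L f = laplacian f by rewrite lfunE.
have SE f : S f = \sum_x f x by rewrite lfunE.
have sub : (limg L <= lker S)%VS.
  apply/subvP=> f /memv_imgP[g _ ->].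
  by rewrite memv_ker SE LE sum_laplacian.
have kerL : (lker L <= <[([ffun=> 1] : {ffun G -> R^o})]>)%VS.
  apply/subvP=> f; rewrite memv_ker LE => /eqP f0.
  apply/vlineP; exists (f u); apply/ffunP=> x; rewrite !ffunE.
  by rewrite (laplacian_eq0 f0 x u) /GRing.scale /= mulr1.
have imgS : (\dim (limg S) > 0)%N.
  rewrite lt0n dimv_eq0; apply/eqP=> S0.
  have : S [ffun x => (x == u)%:R] \in limg S by rewrite memv_img ?memvf.
  rewrite S0 memv0 SE (bigD1 u) //= ffunE eqxx big1 ?addr0 ?oner_eq0 //.
  by move=> x /negPf xu; rewrite ffunE xu.
have dimL := limg_ker_dim L fullv; have dimS := limg_ker_dim S fullv.
rewrite !capfv in dimL dimS.
have kerL1 : (\dim (lker L) <= 1)%N.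
  by apply: leq_trans (dimvS kerL) _; rewrite dim_vline; case: eqP.
have /eqP eqLS : limg L == lker S.
  rewrite eqEdim sub /= -(leq_add2r 1) -(leq_add2l 0) !add0n.
  apply: (@leq_trans (\dim (lker S) + \dim (limg S))); first by rewrite leq_add2l.
  by rewrite dimS -dimL addnC leq_add2l.
rewrite -LE -/L limg_lfunVK // eqLS memv_ker SE.
under eq_bigr do rewrite ffunE.
have sum1 w : \sum_(x : G) (x == w)%:R = 1 :> R.
  by rewrite (bigD1 w) //= eqxx big1 ?addr0 // => x /negPf ->.
by rewrite sumrB !sum1 subrr.
Qed.

Lemma resistanceE u v phi :
  unit_current_potential u v phi -> resistance u v = phi u - phi v.
Proof.
move=> phiP; have psiP := resistance_potentialP u v.
have /laplacian_eq0/(_ u v) : laplacian (resistance_potential u v - phi) = 0.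
  by rewrite linearB /= phiP psiP subrr.
rewrite !ffunE /resistance => /eqP; rewrite subr_eq => /eqP ->.
by rewrite addrC -addrA addKr addrC.
Qed.

End Resistance.

(* Subdivision of a graph with vertex set V and edges src e -- tgt e (e : E),
   the edge e receiving m e new vertices. *)
Section Subdivision.
Variables (V E : finType) (src tgt : E -> V) (m : E -> nat).

Definition subdivision_vertex := (V + {e : E & 'I_(m e)})%type.

(* The p-th vertex on the path replacing e: src e for p = 0, the new vertices
   for 1 <= p <= m e, and tgt e for p = (m e).+1. *)
Definition subdivision_pos (e : E) (p : nat) : subdivision_vertex :=
  if p is q.+1 then
    if insub q is Some a then inr (Tagged (fun e => 'I_(m e)) (a : 'I_(m e)))
    else inl (tgt e)
  else inl (src e).

Definition subdivision_adj : rel subdivision_vertex := fun x y =>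
  [exists e, exists p : 'I_(m e).+1,
    ((x == subdivision_pos e p) && (y == subdivision_pos e p.+1)) ||
    ((y == subdivision_pos e p) && (x == subdivision_pos e p.+1))].

Lemma subdivision_sym : symmetric subdivision_adj.
Proof.
by move=> x y; apply: eq_existsb => e; apply: eq_existsb => p; rewrite orbC.
Qed.

Lemma subdivision_irr :
  (forall e, src e != tgt e) -> irreflexive subdivision_adj.
Proof.
move=> st x; apply/existsP=> -[e /existsP[p]]; rewrite orbb => /andP[/eqP-> ].
case: p => -[|q] /= qm; rewrite /subdivision_pos.
  case: insubP => [a _ _|_] // /eqP[] /eqP; exact/negP/st.
case: insubP => [a _ aq|/negP[]]; last by rewrite -ltnS.
case: insubP => [b _ bq|_] //.
rewrite -[_ == _]/(Tagged (fun e => 'I_(m e)) (a : 'I_(m e)) ==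
                   Tagged (fun e => 'I_(m e)) (b : 'I_(m e))).
by rewrite eq_Tagged -val_eqE /= aq bq ltn_eqF.
Qed.

Lemma subdivision_connected :
  (forall x y, connect (fun a b => [exists e, ((src e == a) && (tgt e == b)) ||
                                     ((src e == b) && (tgt e == a))]) x y) ->
  forall x y, connect subdivision_adj x y.
Proof.
move=> conn.
have csym := sym_connect_sym subdivision_sym.
have pos e p : (p <= (m e).+1)%N ->
    connect subdivision_adj (inl (src e)) (subdivision_pos e p).
  elim: p => [|p IHp] pm; first exact: connect0.
  apply: connect_trans (IHp (ltnW pm)) (connect1 _).
  apply/existsP; exists e; apply/existsP; exists (Ordinal pm).
  by rewrite !eqxx.
have edge e : connect subdivision_adj (inl (src e)) (inl (tgt e)).
  have := pos e (m e).+1 (leqnn _).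
  by rewrite /subdivision_pos insubF // ltnn.
have old x y : connect subdivision_adj (inl x) (inl y).
  have /connectP[s xs ->] := conn x y.
  elim: s x xs => [|z s IHs] x /=; first by rewrite connect0.
  case/andP=> /existsP[e exz] /IHs; apply: connect_trans.
  case/orP: exz => /andP[/eqP<- /eqP<-] //; by rewrite csym.
have new x : exists y, connect subdivision_adj (inl y) x.
  case: x => [x|[e a]]; first by exists x.
  exists (src e); have := pos e a.+1 (leqW (ltn_ord a)).
  by rewrite /subdivision_pos valK.
move=> x y; have [x' xx'] := new x; have [y' yy'] := new y.
by apply: connect_trans (connect_trans (old x' y') yy'); rewrite csym.
Qed.

Definition subdivision (st : forall e, src e != tgt e) conn : graph :=
  Graph subdivision_sym (subdivision_irr st) (subdivision_connected conn).

End Subdivision.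

(* The vertex (b, j) of the linear quadrilateral chain is t_j if b = true and
   s_j if b = false. The edge inl (b, i) is the top (b = true) or bottom
   (b = false) edge of the square S_(i+1), from index i to index i.+1; the edge
   inr j is t_j s_j. *)
Section QuadrilateralChain.
Variable h : nat.

Definition quad_vertex := (bool * 'I_h.+1)%type.
Definition quad_edge := (bool * 'I_h + 'I_h.+1)%type.

Definition quad_src (e : quad_edge) : quad_vertex :=
  match e with
  | inl (b, i) => (b, widen_ord (leqnSn h) i)
  | inr j => (true, j)
  end.

Definition quad_tgt (e : quad_edge) : quad_vertex :=
  match e with
  | inl (b, i) => (b, lift ord0 i)
  | inr j => (false, j)
  end.

Lemma quad_src_neq_tgt e : quad_src e != quad_tgt e.
Proof.
case: e => [[b i]|j] //=; rewrite xpair_eqE eqxx /= -val_eqE /=.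
by rewrite /bump /= add1n neq_ltn ltnSn.
Qed.

Lemma quad_connected x y :
  connect (fun a b => [exists e, ((quad_src e == a) && (quad_tgt e == b)) ||
                         ((quad_src e == b) && (quad_tgt e == a))]) x y.
Proof.
set r : rel quad_vertex := fun a b => _.
have rsym : symmetric r.
  by move=> a b; apply: eq_existsb => e; rewrite orbC.
have csym := sym_connect_sym rsym.
have rE e : connect r (quad_src e) (quad_tgt e).
  by apply: connect1; apply/existsP; exists e; rewrite !eqxx.
have top n (nh : (n < h.+1)%N) : connect r (true, ord0) (true, Ordinal nh).
  elim: n nh => [|n IHn] nh.
    by rewrite (_ : Ordinal nh = ord0) ?connect0 //; apply: val_inj.
  apply: connect_trans (IHn (ltnW nh)) _.
  have := rE (inl (true, Ordinal (nh : n < h)%N)); rewrite /quad_src /quad_tgt.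
  congr (connect r (_, _) (_, _)); exact: val_inj.
have all z : connect r (true, ord0) z.
  case: z => -[] [n nh]; first exact: top.
  exact: connect_trans (top n nh) (rE (inr (Ordinal nh))).
by apply: connect_trans (all y); rewrite csym.
Qed.

End QuadrilateralChain.

Section PolycyclicChain.
Variables (k h : nat).

(* With 0-based indices, the weight entry i.-1 governs the square i, for
   0 < i < h.-1; the squares 0 and h.-1 are the two terminal ones. *)
Definition chain_weight := ((h - 2).-tuple 'I_(k - 4).+1)%type.

Definition chain_subdiv (w : chain_weight) (e : quad_edge h) : nat :=
  match e with
  | inl (b, i) =>
      if (i == 0 :> nat) || (i == h.-1 :> nat) then
        if b then uphalf (k - 4) else (k - 4)./2
      else
        let wi := nth ord0 w i.-1 in if b then wi : nat else (k - 4 - wi)%N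
  | inr _ => 0
  end.

Definition poly_chain (w : chain_weight) : graph :=
  subdivision (chain_subdiv w) (@quad_src_neq_tgt h) (@quad_connected h).

Definition polycyclic_chain (G : graph) : Prop :=
  exists w : chain_weight, isomorphic G (poly_chain w).

Fact half_bound : ((k - 4)./2 < (k - 4).+1)%N.
Proof. by rewrite ltnS -{2}[(k - 4)%N]odd_double_half -addnn addnA leq_addl. Qed.

Fact uphalf_bound : (uphalf (k - 4) < (k - 4).+1)%N.
Proof. by rewrite ltnS uphalf_half -{3}[(k - 4)%N]odd_double_half -addnn addnA leq_addr. Qed.

Definition floor_entry : 'I_(k - 4).+1 := Ordinal half_bound.
Definition ceil_entry : 'I_(k - 4).+1 := Ordinal uphalf_bound.

Definition floor_ceil_weight : chain_weight :=
  [tuple if odd i then ceil_entry else floor_entry | i < h - 2].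

Definition ceil_floor_weight : chain_weight :=
  [tuple if odd i then floor_entry else ceil_entry | i < h - 2].

(* For k even, floor_entry is (k - 4) / 2. *)
Definition linear_chain : graph := poly_chain [tuple floor_entry | i < h - 2].

Definition zigzag_chain : graph := poly_chain floor_ceil_weight.

End PolycyclicChain.

(* Main.v *)
Require Import Defs.
From mathcomp Require Import all_boot all_order all_algebra zify ring lra.

(** Regard the outer boundary of a chain as a Hamiltonian cycle of length
    n = m h + 2, m = k - 2, and cut it at the edge t_0 s_0. The h edges outside
    the resulting path are the chords t_j s_j, j < h. With g_j x the number of
    path edges below x that lie between t_j and s_j,
      Omega(x, y) = |x - y| - \sum_(i, j) H_ij (g_i x - g_i y) (g_j x - g_j y),
    where H is the inverse of the Gram matrix B_ij = [i = j] + l_(max i j) of the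
    fundamental cycles, l_j = s_j - t_j. Neither B nor H depends on w, and
    H = 1 - P with all entries of P positive. Summing over all pairs x, y gives
      Kf = C + \sum_(0 < i < j) P_ij (n - l_i) l_j (t_j - t_i) (s_i - s_j),
    where C, P and l depend on k and h only.
    As (t_j - t_i) + (s_i - s_j) = m (j - i), each product is largest when its
    two factors are balanced. The weights floor, ceil, floor, ... balance all of
    them at once, and the terms j = i + 1 and j = i + 2 leave no other choice
    but ceil, floor, ceil, ..., whose chain is obtained by the reflection
    x |-> - x of the boundary cycle. *)

Set Implicit Arguments.
Unset Strict Implicit.
Unset Printing Implicit Defensive.

Import Order.TTheory GRing.Theory Num.Theory.
Local Open Scope ring_scope.

(** * The inverse of the Gram matrix *)

Section GreenKernel.
Local Open Scope nat_scope.
Variable m : nat.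

(* The coordinates satisfy a (j + 2) = (m + 2) a (j + 1) - a j, a 0 = 0, a 1 = 1,
   and p j = a (j + 1) - a j. *)
Fixpoint chain_seq (j : nat) : nat * nat :=
  if j is i.+1 then
    let: (a, p) := chain_seq i in (a + p, p + m * (a + p))
  else (0, 1).

Definition chain_a j := (chain_seq j).1.
Definition chain_p j := (chain_seq j).2.

Lemma chain_aS j : chain_a j.+1 = chain_a j + chain_p j.
Proof. by rewrite /chain_a /chain_p /=; case: chain_seq. Qed.

Lemma chain_pS j : chain_p j.+1 = chain_p j + m * chain_a j.+1.
Proof. by rewrite /chain_a /chain_p /=; case: chain_seq. Qed.

Lemma chain_p_gt0 j : 0 < chain_p j.
Proof. by elim: j => [|j IHj] //; rewrite chain_pS addn_gt0 IHj. Qed.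

Lemma chain_a_gt0 j : 0 < chain_a j.+1.
Proof. by rewrite chain_aS addn_gt0 chain_p_gt0 orbT. Qed.

(** For [m > 0], [chain_a] is a hyperbolic sine up to scaling, and this is its addition formula; the
    induction moves one unit from [j] to [i]. *)
Lemma chain_a_add i j :
  chain_a (i + j).+1 = chain_p j * chain_a i.+1 + chain_p i * chain_a j.
Proof.
elim: j i => [|j IHj] i; first by rewrite addn0 muln0 addn0 mul1n.
by rewrite addnS -addSn IHj [chain_a i.+2]chain_aS !chain_pS [chain_a j.+1]chain_aS; ring.
Qed.

Variable h : nat.

(** The number [l_r] of path edges from [t_r] to [s_r]: each square from [r] on contributes [m], top
    and bottom together, and the edge [t_h s_h] adds 1. *)
Definition chord_len r := m * (h - r) + 1.

(** A discrete Green function: a product of two solutions of the recurrence above, one started at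
    each end. Divided by [chain_a h.+1] it is the matrix [P]. *)
Definition green i j := chain_p (minn i j) * chain_p (h - maxn i j).

Lemma greenC i j : green i j = green j i.
Proof. by rewrite /green minnC maxnC. Qed.

Lemma green_gt0 i j : 0 < green i j.
Proof. by rewrite muln_gt0 !chain_p_gt0. Qed.

(** As [chain_p] is the difference of [chain_a], the sums telescope. The correction term is the rest
    of the row, [z < i <= h], with the index [h] included; adding it avoids truncated
    subtraction. *)
Lemma green_row_sum j z : j < h -> z < h ->
  \sum_(0 <= i < z.+1) green j i + (j <= z) * (chain_p j * chain_a (h - z)) =
  if j <= z then chain_a h.+1 else chain_p (h - j) * chain_a z.+1.
Proof.
move=> jh; elim: z => [|z IHz] zh.
  rewrite big_nat1 leqn0; case: (eqVneq j 0) => [->|j0].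
    by rewrite /green minn0 maxn0 subn0 !mul1n chain_aS addnC.
  rewrite /green minn0 maxn0 mul0n addn0 mul1n.
  by rewrite (_ : chain_a 1 = 1) // muln1.
rewrite big_nat_recr //=; have {IHz} := IHz (ltnW zh).
case: (ltngtP j z.+1) => [jz|zj|->].
- have -> : j <= z by lia.
  rewrite !mul1n /green.
  have -> : h - z = (h - z.+1).+1 by lia.
  have -> : minn j z.+1 = j by lia.
  have -> : maxn j z.+1 = z.+1 by lia.
  by rewrite chain_aS => <-; ring.
- have -> : (j <= z) = false by lia.
  rewrite !mul0n !addn0 => ->; rewrite /green.
  have -> : minn j z.+1 = z.+1 by lia.
  have -> : maxn j z.+1 = j by lia.
  by rewrite [chain_a z.+2]chain_aS; ring.
- have -> : (z < z) = false by rewrite ltnn.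
  rewrite mul0n addn0 mul1n => ->; rewrite /green minnn maxnn.
  have -> : chain_a h.+1 = chain_a ((h - z.+1) + z.+1).+1 by congr chain_a; lia.
  by rewrite chain_a_add [chain_a (h - z.+1).+1]chain_aS; ring.
Qed.

(** After division by [chain_a h.+1] this reads [P (1 + L) = L], with [L] the matrix of the
    [l_(max i j)]; hence [1 - P] inverts [B = 1 + L]. *)
Lemma green_chord_len i j : i < h -> j < h ->
  green i j + \sum_(0 <= r < h) green i r * chord_len (maxn r j) =
  chain_a h.+1 * chord_len (maxn i j).
Proof.
move=> ih jh.
(* Descending induction on [j]: in the last column, [j = h - 1], the lengths do not depend on
   [r]. *)
have [d dE] : exists d, j + d = h.-1 by exists (h.-1 - j); lia.
elim: d j dE jh => [|d IHd] j jd jh.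
  have Ej : h = j.+1 by lia.
  have -> : \sum_(0 <= r < h) green i r * chord_len (maxn r j) =
            (\sum_(0 <= r < h) green i r) * chord_len j.
    rewrite big_distrl /=; apply: eq_big_nat => r rh.
    by congr (_ * chord_len _); lia.
  have := green_row_sum ih jh; rewrite -Ej.
  have -> : i <= j by lia.
  have -> : maxn i j = j by lia.
  have -> : h - j = 1 by lia.
  rewrite /green mul1n (_ : chain_a 1 = 1) // muln1 => <-.
  have -> : minn i j = i by lia.
  have -> : maxn i j = j by lia.
  rewrite /chord_len (_ : h - j = 1); last by lia.
  by rewrite (_ : chain_p 1 = 1 + m * 1) //; ring.
have jh1 : j.+1 < h by lia.
have := IHd j.+1 (etrans (addSnnS _ _) jd) jh1.
(* From column [j + 1] to column [j] the lengths grow by [m] exactly in the rows [r <= j], so a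
   partial row sum of [green] accounts for the change. *)
have -> : \sum_(0 <= r < h) green i r * chord_len (maxn r j) =
    \sum_(0 <= r < h) green i r * chord_len (maxn r j.+1) +
    m * \sum_(0 <= r < j.+1) green i r.
  rewrite (big_cat_nat (n := j.+1)) //= [X in _ = X + _](big_cat_nat (n := j.+1)) //=.
  rewrite [RHS]addnAC; congr (_ + _).
    rewrite big_distrr -big_split /=; apply: eq_big_nat => r /andP[_ rj].
    rewrite /chord_len (_ : maxn r j = j); last by lia.
    rewrite (_ : maxn r j.+1 = j.+1); last by lia.
    rewrite (_ : h - j = (h - j.+1).+1); last by lia.
    by ring.
  apply: eq_big_nat => r /andP[rj _].
  by congr (_ * chord_len _); lia.
have := green_row_sum ih jh.
case: (leqP i j) => ij.
  rewrite mul1n /green (_ : minn i j.+1 = i); last by lia.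
  rewrite (_ : maxn i j.+1 = j.+1); last by lia.
  rewrite (_ : minn i j = i); last by lia.
  rewrite (_ : maxn i j = j); last by lia.
  rewrite /chord_len (_ : h - j = (h - j.+1).+1); last by lia.
  set T := chain_a h.+1 => rowE IH.
  have -> : T * (m * (h - j.+1).+1 + 1) = T * (m * (h - j.+1) + 1) + m * T by ring.
  by rewrite -IH -rowE chain_pS; ring.
rewrite mul0n addn0 => ->.
rewrite /green (_ : minn i j.+1 = j.+1); last by lia.
rewrite (_ : minn i j = j); last by lia.
rewrite (_ : maxn i j.+1 = i); last by lia.
rewrite (_ : maxn i j = i); last by lia.
by move=> <-; rewrite chain_pS; ring.
Qed.

End GreenKernel.

(** * Sums over a cycle *)

Section CyclicDistance.
Variables (R : realFieldType) (n : nat).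

Definition distn (x y : nat) : nat := ((x - y) + (y - x))%N.

(* For x, y < n this is g (n - g), g being a distance on an n-cycle. *)
Definition cyc_prod (x y : nat) : R := (distn x y)%:R * (n%:R - (distn x y)%:R).

Lemma sum_cyc_prod_point l x : (x < l)%N ->
  \sum_(e < l) cyc_prod e x =
  \sum_(e < l) cyc_prod e 0 + (n%:R - l%:R) * x%:R * (x%:R + 1 - l%:R).
Proof.
elim: x => [|x IHx] xl; first by rewrite mulr0 mul0r addr0.
(* Translating by one makes the range of [e] lose its last term and gain a new first one. *)
have step : \sum_(e < l) cyc_prod e x.+1 =
    cyc_prod 0 x.+1 + \sum_(e < l) cyc_prod e x - cyc_prod l.-1 x.
  case: l xl {IHx} => // l _; rewrite big_ord_recl big_ord_recr /=.
  rewrite -addrA addrK; congr (_ + _); exact: eq_bigr.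
rewrite step IHx ?(ltnW xl) // /cyc_prod /distn.
rewrite (_ : 0 - x.+1 + (x.+1 - 0) = x + 1)%N ; last by lia.
rewrite (_ : l.-1 - x + (x - l.-1) = l - (x + 1))%N; last by lia.
by rewrite natrB ?natrD -?[x.+1]addn1 ?natrD; [ring|lia].
Qed.

(** The origin of the products in the Kirchhoff index: [u] and [l - l' - u] are the gaps on the two
    sides of the inner interval within the outer one. *)
Lemma sum_cyc_prod_interval l l' u : (u + l' <= l)%N ->
  \sum_(e < l) \sum_(f < l') cyc_prod e (u + f) =
  \sum_(e < l) \sum_(f < l') cyc_prod e f -
  (n%:R - l%:R) * l'%:R * (u%:R * (l - l' - u)%:R).
Proof.
move=> ul; rewrite exchange_big /= [X in _ = X - _]exchange_big /=.
have pointE (g : nat -> nat) : (forall f, f < l' -> g f < l)%N ->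
    \sum_(f < l') \sum_(e < l) cyc_prod e (g f) =
    \sum_(f < l') (\sum_(e < l) cyc_prod e 0 +
      (n%:R - l%:R) * (g f)%:R * ((g f)%:R + 1 - l%:R)).
  by move=> gl; apply: eq_bigr => f _; rewrite sum_cyc_prod_point // gl.
rewrite (pointE (addn u)) => [|f fl']; last by lia.
rewrite (pointE id) => [|f fl']; last by lia.
rewrite {pointE} !big_split /= -addrA; congr (_ + _).
have sumE (c : R) : \sum_(f < l') (n%:R - l%:R) * (u + f)%:R * ((u + f)%:R + 1 - c) =
    \sum_(f < l') (n%:R - l%:R) * f%:R * (f%:R + 1 - c) +
    (n%:R - l%:R) * (l'%:R * u%:R * (u%:R + l'%:R - c)).
  elim: l' {ul} => [|l' IHl']; first by rewrite !big_ord0; ring.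
  by rewrite !big_ord_recr /= IHl' -[l'.+1]addn1 !natrD; ring.
by rewrite sumE -subnDA natrB 1?addnC // natrD; ring.
Qed.

Lemma sum_pair_prod (a b : nat -> R) :
  \sum_(x < n) \sum_(y < n) (a x - a y) * (b x - b y) =
  2 * (n%:R * (\sum_(x < n) a x * b x) - (\sum_(x < n) a x) * (\sum_(x < n) b x)).
Proof.
have E x : \sum_(y < n) (a x - a y) * (b x - b y) =
    n%:R * (a x * b x) - a x * (\sum_(y < n) b y) - (\sum_(y < n) a y) * b x +
    \sum_(y < n) a y * b y.
  rewrite mulr_sumr mulr_suml -[n in n%:R * _]card_ord mulr_natl -sumr_const.
  rewrite -!sumrN -!big_split /=; apply: eq_bigr => y _; ring.
under eq_bigr do rewrite E.
rewrite !big_split /= !sumrN -mulr_sumr -mulr_suml -mulr_sumr sumr_const card_ord.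
by rewrite -[X in _ + X = _]mulr_natl; ring.
Qed.

Lemma sum_gt e : (e < n)%N -> \sum_(x < n) ((e < x)%N%:R : R) = n%:R - 1 - e%:R.
Proof.
elim: n => // n' IHn en; rewrite big_ord_recr /=.
have [{}en|ne] := ltnP e n'; first by rewrite IHn //= -[n'.+1]addn1 natrD; ring.
have -> : e = n' by lia.
rewrite big1 => [|i _]; first by rewrite /= -[n'.+1]addn1 natrD; ring.
by rewrite ltnNge (ltnW (ltn_ord i)).
Qed.

(** [(e < x) - (e < y)] is nonzero when the path edge from [e] to [e + 1] separates [x] from [y].
    The count of doubly separated pairs is arranged so that only [cyc_prod] involves [e] and [f]
    jointly. *)
Lemma sum_separated_pairs e f : (e < n)%N -> (f < n)%N ->
  \sum_(x < n) \sum_(y < n) ((e < x)%N%:R - (e < y)%N%:R) *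
     ((f < x)%N%:R - (f < y)%N%:R) =
  e.+1%:R * (n%:R - 1 - e%:R) + f.+1%:R * (n%:R - 1 - f%:R) - cyc_prod e f.
Proof.
wlog ef : e f / (e <= f)%N => [IH|] en fn.
  have [ef|fe] := leqP e f; first exact: IH.
  rewrite /cyc_prod /distn addnC -/(distn f e) -/(cyc_prod f e).
  rewrite [X in X - _]addrC -IH ?(ltnW fe) //.
  by apply: eq_bigr => x _; apply: eq_bigr => y _; rewrite mulrC.
rewrite (sum_pair_prod (fun x => (e < x)%N%:R) (fun x => (f < x)%N%:R)) /=.
have -> : \sum_(x < n) ((e < x)%N%:R * (f < x)%N%:R) = \sum_(x < n) ((f < x)%N%:R : R).
  apply: eq_bigr => x _; rewrite -natrM mulnb.
  by congr ((nat_of_bool _)%:R); apply/andP/idP => [[]//|fx]; split=> //; lia.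
rewrite !sum_gt // /cyc_prod /distn (_ : e - f = 0)%N ?add0n; last by lia.
by rewrite natrB // -[e.+1]addn1 -[f.+1]addn1 !natrD; ring.
Qed.

End CyclicDistance.

(** * Resistances and the Kirchhoff index *)

Section ChainModel.
Variables (R : realFieldType) (m h : nat) (u v : nat -> nat).

(** [u i] and [v i] are the numbers of edges on the top and the bottom of square [i]. The boundary
    is read from [t_0] at position 0 along the top to [t_h], then back along the bottom to [s_0] at
    the last position. *)
Definition chain_order := (m * h + 2)%N.
Definition top_pos j := (\sum_(0 <= i < j) u i)%N.
Definition bot_pos j := (chain_order.-1 - \sum_(0 <= i < j) v i)%N.

Local Notation n := chain_order.
Local Notation t := top_pos.
Local Notation s := bot_pos.
Local Notation ell := (chord_len m h).

(** Only [j < h] occurs: the edge [t_h s_h] joins consecutive positions and lies on the path. *)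
Definition is_chord (x y : nat) : bool :=
  [exists j : 'I_h, ((x == t j) && (y == s j)) || ((x == s j) && (y == t j))].

Definition chain_adj (x y : nat) : bool :=
  [|| y == x.+1, x == y.+1 | is_chord x y].

Hypotheses (h_gt0 : (0 < h)%N) (u_gt0 : forall i, (0 < u i)%N)
  (v_gt0 : forall i, (0 < v i)%N) (uvE : forall i, (u i + v i)%N = m).

(** * Positions of the chord ends on the boundary path *)

Lemma top_pos0 : t 0 = 0%N. Proof. by rewrite /t big_nil. Qed.

Lemma bot_pos0 : s 0 = n.-1. Proof. by rewrite /s big_nil subn0. Qed.

Lemma top_posS j : t j.+1 = (t j + u j)%N.
Proof. by rewrite /t big_nat_recr. Qed.

Lemma top_add_bot j : (j <= h)%N ->
  (\sum_(0 <= i < j) u i + \sum_(0 <= i < j) v i = m * j)%N.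
Proof.
move=> jh; rewrite -big_split /=.
under eq_bigr do rewrite uvE.
by rewrite sum_nat_const_nat subn0 mulnC.
Qed.

Lemma bot_posE j : (j <= h)%N -> s j = (t j + ell j)%N.
Proof.
move=> jh; have := top_add_bot jh; rewrite /s /t /chord_len /chain_order.
have : (m * j <= m * h)%N by rewrite leq_mul2l jh orbT.
rewrite mulnBr; lia.
Qed.

Lemma bot_posS j : (j < h)%N -> s j = (s j.+1 + v j)%N.
Proof.
move=> jh; have := top_add_bot jh; rewrite /s.
have : (m * j.+1 <= m * h)%N by rewrite leq_mul2l jh orbT.
rewrite /chain_order !big_nat_recr //=; lia.
Qed.

Lemma top_pos_lt i j : (i < j)%N -> (t i < t j)%N.
Proof.
elim: j => // j IHj; rewrite ltnS leq_eqVlt top_posS => /orP[/eqP->|/IHj].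
  by rewrite -addn1 leq_add2l.
by move=> /leq_trans->//; rewrite leq_addr.
Qed.

Lemma bot_pos_gt i j : (i < j)%N -> (j <= h)%N -> (s j < s i)%N.
Proof.
elim: j => // j IHj; rewrite ltnS leq_eqVlt => /orP[/eqP->|ij] jh.
  by rewrite [s j]bot_posS // -addn1 leq_add2l.
apply: leq_trans (IHj ij (ltnW jh)); rewrite [s j]bot_posS //.
by rewrite ltnS leq_addr.
Qed.

Lemma top_pos_le i j : (i <= j)%N -> (t i <= t j)%N.
Proof. by rewrite leq_eqVlt => /orP[/eqP->//|/top_pos_lt/ltnW]. Qed.

Lemma bot_pos_ge i j : (i <= j)%N -> (j <= h)%N -> (s j <= s i)%N.
Proof. by rewrite leq_eqVlt => /orP[/eqP->//|ij jh]; apply/ltnW/bot_pos_gt. Qed.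

Lemma top_lt_bot i j : (i <= h)%N -> (j <= h)%N -> (t i < s j)%N.
Proof.
move=> ih jh; apply: leq_trans (bot_pos_ge jh (leqnn h)).
by rewrite bot_posE // /chord_len subnn muln0 add0n addn1 ltnS top_pos_le.
Qed.

Lemma bot_pos_lt j : (s j < n)%N.
Proof. by rewrite /s /chain_order; lia. Qed.

Lemma top_pos_lt_order j : (j <= h)%N -> (t j < n)%N.
Proof. by move=> jh; apply: ltn_trans (bot_pos_lt j); apply: top_lt_bot. Qed.

Lemma chord_gap j : (j < h)%N -> (t j + 2 < s j)%N.
Proof.
move=> jh; rewrite (bot_posE (ltnW jh)) ltn_add2l /chord_len.
have : (2 <= m)%N by rewrite -(uvE 0); have := u_gt0 0; have := v_gt0 0; lia.
have hj : (0 < h - j)%N by rewrite subn_gt0.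
by move=> m2; have := leq_mul m2 hj; lia.
Qed.

Lemma top_pos_inj i j : t i = t j -> i = j.
Proof. by case: (ltngtP i j) => // /top_pos_lt; lia. Qed.

Lemma bot_pos_inj i j : (i <= h)%N -> (j <= h)%N -> s i = s j -> i = j.
Proof.
by move=> ih jh; case: (ltngtP i j) => // ij; have := bot_pos_gt ij; lia.
Qed.

(** A chord spans more than two path edges and distinct chords share no end, so at most one summand
    is 1. The sum form splits the Laplacian into path edges and chords. *)
Lemma chain_adjE x y : chain_adj x y =
  ((y == x.+1) + (x == y.+1) +
  \sum_(j < h) ((x == t j) * (y == s j) + (x == s j) * (y == t j)))%N :> nat.
Proof.
have chordE : (\sum_(j < h) ((x == t j) * (y == s j) + (x == s j) * (y == t j)) =
    is_chord x y)%N.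
  rewrite /is_chord; case: existsP => [[j xy]|no].
    rewrite (bigD1 j) //= big1 ?addn0 => [|i ij].
      have := top_lt_bot (ltnW (ltn_ord j)) (ltnW (ltn_ord j)).
      by case/orP: xy => /andP[/eqP-> /eqP->]; rewrite !eqxx; lia.
    have neq : (i : nat) != j by [].
    have ti := contra_neq (@top_pos_inj i j) neq.
    have si := contra_neq (bot_pos_inj (ltnW (ltn_ord i)) (ltnW (ltn_ord j))) neq.
    have := top_lt_bot (ltnW (ltn_ord i)) (ltnW (ltn_ord j)).
    have := top_lt_bot (ltnW (ltn_ord j)) (ltnW (ltn_ord i)).
    by case/orP: xy => /andP[/eqP-> /eqP->]; lia.
  rewrite big1 // => j _; apply/eqP; rewrite addn_eq0 !muln_eq0 !eqb0 -!negb_and.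
  by rewrite -negb_or; apply/negP=> xy; apply: no; exists j.
rewrite chordE /chain_adj.
have : is_chord x y -> (x + 2 < y)%N || (y + 2 < x)%N.
  by case/existsP=> j /orP[]/andP[/eqP-> /eqP->]; rewrite chord_gap ?orbT.
by case: is_chord => [/(_ isT)|_]; lia.
Qed.

(** * The Laplacian in path coordinates *)

Definition chain_lap (F : nat -> R) (z : nat) : R :=
  \sum_(i < n | chain_adj z i) (F z - F i).

Definition chord_sign j z : R := (z == s j)%:R - (z == t j)%:R.

Lemma sum_delta (c : nat) (g : nat -> R) :
  \sum_(i < n) (i == c :> nat)%:R * g i = (c < n)%N%:R * g c.
Proof.
have [cn|nc] := ltnP c n.
  rewrite (bigD1 (Ordinal cn)) //= eqxx big1 ?addr0 // => i ic.
  by rewrite (negPf (ic : (i : nat) != c)) mul0r.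
rewrite mul0r big1 // => i _; rewrite (_ : _ == _ = false) ?mul0r //.
by have := ltn_ord i; lia.
Qed.

Lemma chain_lapE F z : (z < n)%N ->
  chain_lap F z = (z.+1 < n)%N%:R * (F z - F z.+1) +
    (0 < z)%N%:R * (F z - F z.-1) +
    \sum_(j < h) chord_sign j z * (F (s j) - F (t j)).
Proof.
move=> zn; rewrite /chain_lap big_mkcond /=.
have -> : \sum_(i < n) (if chain_adj z i then F z - F i else 0) =
  \sum_(i < n) ((i == z.+1 :> nat)%:R * (F z - F i) +
   (0 < z)%N%:R * ((i == z.-1 :> nat)%:R * (F z - F i)) +
   \sum_(j < h) ((z == t j)%:R * ((i == s j :> nat)%:R * (F z - F i)) +
                 (z == s j)%:R * ((i == t j :> nat)%:R * (F z - F i)))).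
  apply: eq_bigr => i _; transitivity ((chain_adj z i)%:R * (F z - F i)).
    by case: chain_adj; rewrite ?mul1r ?mul0r.
  rewrite chain_adjE !natrD !mulrDl natr_sum mulr_suml; congr (_ + _ + _).
    rewrite mulrA -natrM; congr (_%:R * _); lia.
  by apply: eq_bigr => j _; rewrite natrD !natrM mulrDl !mulrA.
rewrite !big_split /= (sum_delta z.+1 (fun i => F z - F i)) -mulr_sumr.
rewrite (sum_delta z.-1 (fun i => F z - F i)).
rewrite (_ : z.-1 < n)%N ?mul1r; last by lia.
congr (_ + _); rewrite exchange_big /=; apply: eq_bigr => j _.
rewrite big_split /= -!mulr_sumr.
rewrite (sum_delta (s j) (fun i => F z - F i)) (sum_delta (t j) (fun i => F z - F i)).
rewrite bot_pos_lt (top_pos_lt_order (ltnW (ltn_ord j))) /chord_sign !mul1r.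
by case: eqP => [->|_]; case: eqP => [->|_]; rewrite /=; ring.
Qed.

Lemma chain_lapD F G z : chain_lap (fun x => F x + G x) z = chain_lap F z + chain_lap G z.
Proof. by rewrite -big_split /=; apply: eq_bigr => i _; ring. Qed.

Lemma chain_lapZ a F z : chain_lap (fun x => a * F x) z = a * chain_lap F z.
Proof. by rewrite mulr_sumr; apply: eq_bigr => i _; ring. Qed.

Lemma chain_lap_cst a z : chain_lap (fun=> a) z = 0.
Proof. by rewrite /chain_lap big1 // => i _; rewrite subrr. Qed.

Lemma chain_lap_sum (I : finType) (F : I -> nat -> R) z :
  chain_lap (fun x => \sum_i F i x) z = \sum_i chain_lap (F i) z.
Proof.
by rewrite exchange_big; apply: eq_bigr => i _; rewrite sumrB.
Qed.

(* The number of edges of the boundary path from t_j to s_j that precede x;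
   this path closed by the chord j is a fundamental cycle. *)
Definition arc_count j x := (minn x (s j) - t j)%N.

(** The arcs are nested, so arcs [i] and [j] overlap in the shorter one, that of the larger index.
    This gives the summand [l_(max i j)] of the Gram matrix. *)
Lemma arc_count_bot_top i j : (i < h)%N -> (j < h)%N ->
  arc_count i (s j) = (arc_count i (t j) + ell (maxn i j))%N.
Proof.
move=> ih jh; have ti := top_lt_bot (ltnW ih) (ltnW ih).
have si := bot_posE (ltnW ih); have sj := bot_posE (ltnW jh).
have tij := top_lt_bot (ltnW ih) (ltnW jh).
have tji := top_lt_bot (ltnW jh) (ltnW ih).
rewrite /arc_count; case: (leqP i j) => ij.
  by have := bot_pos_ge ij (ltnW jh); have := top_pos_le ij; lia.
by have := bot_pos_gt ij (ltnW ih); have := top_pos_lt ij; lia.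
Qed.

(** Row [i] of [B]: the path edges give the dipole of chord [i], because [arc_count i] has slope 1
    on its arc and 0 outside; the chords give the lengths [l_(max i j)]. *)
Lemma chain_lap_arc_count i z : (i < h)%N -> (z < n)%N ->
  chain_lap (fun x => (arc_count i x)%:R) z =
  \sum_(j < h) ((i == j :> nat)%:R + (ell (maxn i j))%:R) * chord_sign j z.
Proof.
move=> ih zn; rewrite chain_lapE //.
have -> : \sum_(j < h) chord_sign j z * ((arc_count i (s j))%:R - (arc_count i (t j))%:R) =
    \sum_(j < h) (ell (maxn i j))%:R * chord_sign j z.
  apply: eq_bigr => j _; rewrite arc_count_bot_top // natrD; ring.
under [RHS]eq_bigr do rewrite mulrDl.
rewrite big_split /=; congr (_ + _).
rewrite (bigD1 (Ordinal ih)) //= eqxx mul1r [X in _ = _ + X]big1 ?addr0; last first.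
  by move=> j ij; rewrite eq_sym (negPf (ij : (j : nat) != i)) mul0r.
have ti := top_lt_bot (ltnW ih) (ltnW ih); have si := bot_pos_lt i.
have step x : arc_count i x.+1 = (arc_count i x + (t i <= x < s i))%N.
  by rewrite /arc_count; lia.
have E : ((z.+1 < n) * (t i <= z < s i) + (z == s i) =
          (0 < z) * (t i <= z.-1 < s i) + (z == t i))%N by lia.
have {E} := congr1 (fun x : nat => x%:R : R) E; rewrite !natrD !natrM => E.
rewrite /chord_sign step natrD.
have -> : (0 < z)%N%:R * ((arc_count i z)%:R - (arc_count i z.-1)%:R) =
          (0 < z)%N%:R * (t i <= z.-1 < s i)%N%:R :> R.
  by case: z {zn E} => [|z] /=; rewrite ?mul0r // step natrD; ring.
by lra.
Qed.

Lemma chain_lap_distn y z : (y < n)%N -> (z < n)%N ->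
  chain_lap (fun x => (distn x y)%:R) z =
  - 2 * (z == y)%:R + (z == 0%N)%:R + (z == n.-1)%:R +
  \sum_(j < h) chord_sign j z * ((ell j)%:R - 2 * (arc_count j y)%:R).
Proof.
move=> yn zn; rewrite chain_lapE //; congr (_ + _); last first.
  apply: eq_bigr => j _; congr (_ * _); rewrite /=.
  have := bot_posE (ltnW (ltn_ord j)) => sj.
  (* [|s_j - y| - |t_j - y| = l_j - 2 arc_count j y], whether [y] lies before, on or after the
     arc. *)
  have E : (distn (s j) y + 2 * arc_count j y = distn (t j) y + ell j)%N.
    by rewrite /distn /arc_count; lia.
  have {E} := congr1 (fun x : nat => x%:R : R) E; rewrite !natrD natrM => E.
  by lra.
have n2 : (2 <= n)%N by rewrite /chain_order; lia.
have E : ((z.+1 < n) * distn z y + (0 < z) * distn z y + 2 * (z == y) =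
   (z.+1 < n) * distn z.+1 y + (0 < z) * distn z.-1 y + (z == 0) + (z == n.-1))%N.
  have [z0|z0] := ltnP 0 z; have [z1|z1] := ltnP z.+1 n; rewrite !(mul0n,mul1n) /distn; lia.
move: E; move: (distn z y) (distn z.+1 y) (distn z.-1 y) => d d1 d2.
move/(congr1 (fun x : nat => x%:R : R)); rewrite !natrD !natrM => E.
by lra.
Qed.

(** * The inverse Gram matrix and the resistance formula *)

Definition green_ratio i j : R := (green m h i j)%:R / (chain_a m h.+1)%:R.

Definition chord_inv i j : R := (i == j :> nat)%:R - green_ratio i j.

Lemma chord_invC i j : chord_inv i j = chord_inv j i.
Proof. by rewrite /chord_inv /green_ratio greenC eq_sym. Qed.

Lemma chord_invP (i j : 'I_h) :
  \sum_(r < h) chord_inv i r * ((r == j :> nat)%:R + (ell (maxn r j))%:R) = (i == j)%:R.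
Proof.
have deltaE (k : 'I_h) (g : nat -> R) : \sum_(r < h) (r == k :> nat)%:R * g r = g k.
  rewrite (bigD1 k) //= eqxx mul1r big1 ?addr0 // => r rk.
  by rewrite (negPf (rk : (r : nat) != k)) mul0r.
have -> : \sum_(r < h) chord_inv i r * ((r == j :> nat)%:R + (ell (maxn r j))%:R) =
   \sum_(r < h) (r == i :> nat)%:R * ((r == j :> nat)%:R + (ell (maxn r j))%:R) -
   \sum_(r < h) (r == j :> nat)%:R * green_ratio i r -
   \sum_(r < h) green_ratio i r * (ell (maxn r j))%:R.
  rewrite -!sumrB; apply: eq_bigr => r _.
  by rewrite /chord_inv [(i : nat) == r]eq_sym; ring.
rewrite (deltaE i (fun r => (r == j :> nat)%:R + (ell (maxn r j))%:R)).
rewrite (deltaE j (green_ratio i)).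
have := green_chord_len m (ltn_ord i) (ltn_ord j); rewrite big_mkord => E.
have {E} := congr1 (fun x : nat => x%:R : R) E.
rewrite natrD natrM natr_sum => E.
have a0 : (chain_a m h.+1)%:R != 0 :> R by rewrite pnatr_eq0 -lt0n chain_a_gt0.
have -> : (ell (maxn i j))%:R = green_ratio i j +
   \sum_(r < h) green_ratio i r * (ell (maxn r j))%:R.
  apply: (mulfI a0); rewrite -E /green_ratio mulrDr mulrCA mulfV // mulr1.
  congr (_ + _); rewrite mulr_sumr; apply: eq_bigr => r _.
  by rewrite natrM mulrA mulrCA mulfV // mulr1.
by rewrite -val_eqE /=; ring.
Qed.

(** Thomson's principle: the unit flow along the path from [x] to [y] has energy [distn x y]; the
    quadratic form is the energy of its projection on the cycle space, expressed in the fundamental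
    cycles through [H]. *)
Definition chain_resist x y : R := (distn x y)%:R -
  \sum_(i < h) \sum_(j < h) chord_inv i j *
    (((arc_count i x)%:R - (arc_count i y)%:R) *
     ((arc_count j x)%:R - (arc_count j y)%:R)).

Lemma chain_resistC x y : chain_resist x y = chain_resist y x.
Proof.
rewrite /chain_resist /distn addnC; congr (_ - _).
by apply: eq_bigr => i _; apply: eq_bigr => j _; ring.
Qed.

Lemma chain_resistxx x : chain_resist x x = 0.
Proof.
rewrite /chain_resist /distn subnn big1 ?subr0 // => i _.
by rewrite big1 // => j _; rewrite subrr mul0r mulr0.
Qed.

Definition arc_form x y : R :=
  \sum_(i < h) (\sum_(j < h) chord_inv i j * (arc_count j y)%:R) * (arc_count i x)%:R.

Lemma arc_formC x y : arc_form x y = arc_form y x.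
Proof.
rewrite /arc_form; under eq_bigr do rewrite mulr_suml.
rewrite exchange_big /=; apply: eq_bigr => i _; rewrite mulr_suml.
by apply: eq_bigr => j _; rewrite chord_invC; ring.
Qed.

Lemma chain_resistE x y : chain_resist x y =
  (distn x y)%:R + (- arc_form x x + (2 * arc_form x y + - arc_form y y)).
Proof.
have -> : 2 * arc_form x y = arc_form x y + arc_form y x.
  by rewrite [arc_form y x]arc_formC; ring.
rewrite /chain_resist /arc_form; congr (_ + _).
rewrite -!sumrN -!big_split /=; apply: eq_bigr => i _.
rewrite !mulr_suml -!sumrN -!big_split /=; apply: eq_bigr => j _; ring.
Qed.

(** The Laplacian produces a factor [B], which cancels [H]. Doubled, the result offsets the
    [arc_count] terms of [chain_lap_distn]. *)
Lemma chain_lap_arc_form y z : (z < n)%N ->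
  chain_lap (fun x => arc_form x y) z = \sum_(j < h) chord_sign j z * (arc_count j y)%:R.
Proof.
move=> zn; rewrite chain_lap_sum.
under eq_bigr => i _ do rewrite chain_lapZ chain_lap_arc_count ?ltn_ord // mulr_suml.
rewrite exchange_big /=; apply: eq_bigr => j _.
transitivity (\sum_(k < h) (\sum_(i < h) chord_inv j i *
    ((i == k :> nat)%:R + (ell (maxn i k))%:R)) * chord_sign k z * (arc_count j y)%:R).
  rewrite [RHS](eq_bigr (fun k : 'I_h => \sum_(i < h) chord_inv j i *
    ((i == k :> nat)%:R + (ell (maxn i k))%:R) * chord_sign k z * (arc_count j y)%:R)).
    rewrite exchange_big /=; apply: eq_bigr => i _.
    by rewrite mulr_sumr; apply: eq_bigr => k _; rewrite [chord_inv i j]chord_invC; ring.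
  by move=> k _; rewrite !mulr_suml.
under eq_bigr do rewrite chord_invP.
rewrite (bigD1 j) //= eqxx mul1r big1 ?addr0 // => k kj.
by rewrite eq_sym (negPf kj) !mul0r.
Qed.

(* What does not depend on y cancels in differences, so half of
   chain_resist _ y - chain_resist _ x is a potential for a unit current from x
   to y. *)
Lemma chain_lap_resist : exists nu : nat -> R, forall y z, (y < n)%N -> (z < n)%N ->
  chain_lap (fun x => chain_resist x y) z = - 2 * (z == y)%:R + nu z.
Proof.
exists (fun z => (z == 0%N)%:R + (z == n.-1)%:R +
   \sum_(j < h) chord_sign j z * (ell j)%:R -
   chain_lap (fun x => arc_form x x) z) => y z yn zn.
transitivity (chain_lap (fun x => (distn x y)%:R + (-1 * arc_form x x +
    (2 * arc_form x y + - arc_form y y))) z).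
  by apply: eq_bigr => i _; rewrite !chain_resistE; ring.
rewrite !chain_lapD chain_lap_distn // !chain_lapZ chain_lap_cst chain_lap_arc_form //.
rewrite (_ : \sum_(j < h) chord_sign j z * ((ell j)%:R - 2 * (arc_count j y)%:R) =
  \sum_(j < h) chord_sign j z * (ell j)%:R -
  2 * \sum_(j < h) chord_sign j z * (arc_count j y)%:R); first by ring.
by rewrite mulr_sumr -sumrB; apply: eq_bigr => j _; ring.
Qed.

(** * Summation over all pairs of vertices *)

(* The arc of the chord 0, which closes the boundary path to a cycle, is
   completed by that closing edge. *)
Definition arc_len j := if j is 0 then n else ell j.

Lemma arc_len_le i : (i < h)%N -> (t i + arc_len i <= n)%N.
Proof.
case: i => [_|i ih]; first by rewrite top_pos0.
by rewrite /= -bot_posE ?(ltnW ih) // ltnW // bot_pos_lt.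
Qed.

(** Each edge of the arc is tested for preceding [x]. The closing edge of arc 0, at position
    [n - 1], precedes no vertex, so completing the arc changes nothing. *)
Lemma arc_countE i x : (i < h)%N -> (x < n)%N ->
  (arc_count i x)%:R = \sum_(a < arc_len i) (t i + a < x)%N%:R :> R.
Proof.
move=> ih xn.
have -> : arc_count i x = (minn x (t i + arc_len i) - t i)%N.
  rewrite /arc_count; case: i ih => [_|i ih]; last by rewrite bot_posE 1?ltnW.
  by rewrite bot_pos0 top_pos0 /=; lia.
elim: (arc_len i) => [|l IHl]; first by rewrite big_ord0 (_ : (_ - _)%N = 0%N) //; lia.
rewrite big_ord_recr /= -IHl -natrD; congr (_%:R); lia.
Qed.

Definition arc_moment i : R :=
  \sum_(a < arc_len i) (t i + a).+1%:R * (n%:R - 1 - (t i + a)%N%:R).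

Definition arc_prod i j : R :=
  \sum_(a < arc_len i) \sum_(b < arc_len j) cyc_prod R n (t i + a) (t j + b).

Lemma sum_arc_count_prod i j : (i < h)%N -> (j < h)%N ->
  \sum_(x < n) \sum_(y < n)
    ((arc_count i x)%:R - (arc_count i y)%:R) * ((arc_count j x)%:R - (arc_count j y)%:R) =
  (arc_len j)%:R * arc_moment i + (arc_len i)%:R * arc_moment j - arc_prod i j.
Proof.
move=> ih jh.
transitivity (\sum_(a < arc_len i) \sum_(b < arc_len j) \sum_(x < n) \sum_(y < n)
  ((t i + a < x)%N%:R - (t i + a < y)%N%:R) * ((t j + b < x)%N%:R - (t j + b < y)%N%:R) : R).
  symmetry; under eq_bigr do rewrite exchange_big /=.
  rewrite exchange_big /=; apply: eq_bigr => x _.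
  under eq_bigr do rewrite exchange_big /=.
  rewrite exchange_big /=; apply: eq_bigr => y _.
  rewrite !arc_countE // -!sumrB mulr_suml; apply: eq_bigr => a _.
  by rewrite mulr_sumr.
have ltn_arc k (a : 'I_(arc_len k)) : (k < h)%N -> (t k + a < n)%N.
  by move=> kh; have := arc_len_le kh; have := ltn_ord a; lia.
under eq_bigr => a _ do under eq_bigr => b _ do
  rewrite sum_separated_pairs ?ltn_arc //.
rewrite /arc_moment /arc_prod mulr_sumr mulr_natl -[arc_len i in X in _ + X - _]card_ord.
rewrite -sumr_const -sumrN -!big_split /=; apply: eq_bigr => a _.
rewrite [X in _ = X + _ - _]mulr_natl -[arc_len j in X in _ = X + _ - _]card_ord.
by rewrite -sumr_const -sumrN -!big_split.
Qed.

Lemma arc_prodC i j : arc_prod i j = arc_prod j i.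
Proof.
rewrite /arc_prod exchange_big; apply: eq_bigr => a _; apply: eq_bigr => b _.
by rewrite /cyc_prod /distn addnC.
Qed.

Definition arc_prod0 i j : R :=
  \sum_(a < arc_len i) \sum_(b < arc_len j) cyc_prod R n a b.

Lemma arc_prod0C i j : arc_prod0 i j = arc_prod0 j i.
Proof.
rewrite /arc_prod0 exchange_big; apply: eq_bigr => a _; apply: eq_bigr => b _.
by rewrite /cyc_prod /distn addnC.
Qed.

(** Zero for [i = 0]: the completed arc 0 is the entire cycle, in which the position of arc [j] is
    irrelevant. *)
Definition shift_coef i j : R := (n%:R - (arc_len i)%:R) * (arc_len j)%:R.

Definition split_prod i j : R := (t j - t i)%N%:R * (s i - s j)%N%:R.

(** Translation by [t i] turns arc [i] into an initial interval containing arc [j] at offset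
    [t j - t i]; what depends on the weights is confined to the two gaps. *)
Lemma arc_prodE i j : (i <= j)%N -> (j < h)%N ->
  arc_prod i j = arc_prod0 i j - shift_coef i j * split_prod i j.
Proof.
move=> ij jh; have tij := top_pos_le ij.
have shiftE : arc_prod i j = \sum_(a < arc_len i) \sum_(b < arc_len j)
    cyc_prod R n a (t j - t i + b).
  apply: eq_bigr => a _; apply: eq_bigr => b _; rewrite /cyc_prod.
  by rewrite (_ : distn _ _ = distn a (t j - t i + b)) // /distn; lia.
have fits : (t j - t i + arc_len j <= arc_len i)%N.
  case: i ij tij {shiftE} => [|i] ij tij.
    by rewrite top_pos0 subn0; apply: arc_len_le.
  have := bot_pos_ge ij (ltnW jh).
  case: j ij jh tij => // j ij jh tij /=.
  by rewrite !bot_posE ?(ltnW jh) ?(leq_trans ij (ltnW jh)) //; lia.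
rewrite shiftE sum_cyc_prod_interval // /arc_prod0 /shift_coef /split_prod.
(* For [i = 0] the gaps need not agree, as arc 0 has one edge more than [s 0 - t 0]; the coefficient
   vanishes there. *)
case: i ij tij fits {shiftE} => [|i] ij tij fits; first by rewrite subrr !mul0r.
congr (_ - _ * (_ * _%:R)); case: j ij jh tij fits => // j ij jh tij fits.
have := bot_posE (ltnW jh); have := bot_posE (leq_trans ij (ltnW jh)).
have := bot_pos_ge ij (ltnW jh); rewrite /=; lia.
Qed.

Lemma sum_ltn_sym (F : nat -> nat -> R) :
  \sum_(i < h) \sum_(j < h) (if (i < j)%N then F i j else if (j < i)%N then F j i else 0) =
  2 * \sum_(i < h) \sum_(j < h | (i < j)%N) F i j.
Proof.
have -> : \sum_(i < h) \sum_(j < h | (i < j)%N) F i j =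
    \sum_(i < h) \sum_(j < h) (if (i < j)%N then F i j else 0).
  by apply: eq_bigr => i _; rewrite [LHS]big_mkcond.
rewrite mulr_natl mulr2n [X in _ = _ + X]exchange_big -big_split /=.
apply: eq_bigr => i _; rewrite -big_split /=; apply: eq_bigr => j _.
by case: ltngtP; rewrite ?addr0 ?add0r.
Qed.

Definition split_weight i j : R := green_ratio i j * shift_coef i j.

Definition Kirchhoff_base : R :=
  \sum_(x < n) \sum_(y < n) (distn x y)%:R -
  2 * \sum_(a < n) a.+1%:R * (n%:R - 1 - a%:R) +
  \sum_(i < h) \sum_(j < h) chord_inv i j * arc_prod0 i j.

Lemma split_weight_gt0 i j : (0 < i)%N -> (i < h)%N -> (j < h)%N -> 0 < split_weight i j.
Proof.
move=> i0 ih jh; rewrite /split_weight /green_ratio /shift_coef !mulr_gt0 //.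
- by rewrite ltr0n green_gt0.
- by rewrite invr_gt0 ltr0n chain_a_gt0.
- rewrite subr_gt0 ltr_nat; case: i i0 ih => // i _ ih /=.
  have := bot_posE (ltnW ih); have := bot_pos_lt i.+1.
  by have := top_pos_lt (ltn0Sn i); lia.
- by rewrite ltr0n; case: j jh => [_|j _] /=; rewrite /chain_order /chord_len ?addn1 ?addn2.
Qed.

(** The off-diagonal entries of [H] are [- P_ij], and [arc_prodE] subtracts its shifts, so the split
    products enter with a plus sign; those on the diagonal are zero. *)
Lemma sum_chain_resist :
  \sum_(x < n) \sum_(y < n) chain_resist x y =
  Kirchhoff_base +
  2 * \sum_(i < h) \sum_(j < h | (i < j)%N) split_weight i j * split_prod i j.
Proof.
(* The arc lengths form column 0 of [B]: [arc_len 0 = 1 + l_0], and [arc_len j = l_j] for [j > 0].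
   So [H] maps them to the unit vector at 0, and only the moment of the whole cycle survives. *)
have lenE : \sum_(i < h) \sum_(j < h) chord_inv i j * ((arc_len j)%:R * arc_moment i) =
    arc_moment 0.
  transitivity (\sum_(i < h) (i == Ordinal h_gt0)%:R * arc_moment i).
    apply: eq_bigr => i _; rewrite -chord_invP mulr_suml; apply: eq_bigr => j _.
    rewrite mulrA; congr (_ * _ * _); rewrite -natrD; congr (_%:R).
    by case: (nat_of_ord j) => [|j'] /=; rewrite ?maxn0 /chain_order /chord_len; lia.
  rewrite (bigD1 (Ordinal h_gt0)) //= ?eqxx mul1r big1 ?addr0 // => i /negPf ->.
  by rewrite mul0r.
have lenE' : \sum_(i < h) \sum_(j < h) chord_inv i j * ((arc_len i)%:R * arc_moment j) =
    arc_moment 0.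
  rewrite exchange_big /= -[RHS]lenE.
  by apply: eq_bigr => i _; apply: eq_bigr => j _; rewrite chord_invC.
rewrite -(sum_ltn_sym (fun i j => split_weight i j * split_prod i j)) /Kirchhoff_base.
have -> : \sum_(a < n) a.+1%:R * (n%:R - 1 - a%:R) = arc_moment 0.
  by rewrite /arc_moment top_pos0.
have -> : 2 * arc_moment 0 = arc_moment 0 + arc_moment 0 by ring.
rewrite -{1}lenE -lenE' /chain_resist.
under eq_bigr do rewrite sumrB.
rewrite sumrB -!addrA; congr (_ + _).
have -> : \sum_(x < n) \sum_(y < n) \sum_(i < h) \sum_(j < h) chord_inv i j *
      (((arc_count i x)%:R - (arc_count i y)%:R) *
       ((arc_count j x)%:R - (arc_count j y)%:R)) =
    \sum_(i < h) \sum_(j < h) chord_inv i j *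
      ((arc_len j)%:R * arc_moment i + (arc_len i)%:R * arc_moment j - arc_prod i j).
  under eq_bigr do rewrite exchange_big /=.
  rewrite exchange_big /=; apply: eq_bigr => i _.
  under eq_bigr do rewrite exchange_big /=.
  rewrite exchange_big /=; apply: eq_bigr => j _.
  under eq_bigr do rewrite -mulr_sumr.
  by rewrite -mulr_sumr sum_arc_count_prod.
rewrite opprD -!sumrN -!big_split /=; apply: eq_bigr => i _.
rewrite -!sumrN -!big_split /=; apply: eq_bigr => j _.
have [ij|ji|ij] := ltngtP i j.
- rewrite arc_prodE ?(ltnW ij) // /split_weight /chord_inv (_ : _ == _ = false); last by lia.
  by rewrite /=; ring.
- rewrite arc_prodC arc_prodE ?(ltnW ji) // /split_weight [chord_inv i j]chord_invC.
  rewrite [arc_prod0 i j]arc_prod0C /chord_inv (_ : _ == _ = false); last by lia.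
  by rewrite /=; ring.
by rewrite ij arc_prodE // /split_prod subnn; ring.
Qed.

(** * Transfer to a numbered graph *)

Definition chain_numbering (G : graph) (f : G -> 'I_n) : Prop :=
  bijective f /\ forall x y, adj x y = chain_adj (f x) (f y).

Lemma resistance_numbering (G : graph) (f : G -> 'I_n) : chain_numbering f ->
  forall x y, resistance R x y = chain_resist (f x) (f y).
Proof.
move=> [f_bij f_adj] x y; have [nu nuE] := chain_lap_resist.
pose phi : {ffun G -> R^o} :=
  [ffun z => (chain_resist (f z) (f y) - chain_resist (f z) (f x)) / 2].
have phiP : unit_current_potential x y phi.
  apply/ffunP => z; rewrite !ffunE.
  transitivity ((chain_lap (fun i => chain_resist i (f y)) (f z) -
                 chain_lap (fun i => chain_resist i (f x)) (f z)) / 2).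
    rewrite /chain_lap -sumrB mulr_suml.
    rewrite [RHS](reindex f) /=; last exact: onW_bij.
    by apply: eq_big => [w|w _]; [rewrite f_adj | rewrite !ffunE; ring].
  rewrite !nuE // !val_eqE !(bij_eq f_bij); lra.
rewrite (resistanceE phiP) !ffunE !chain_resistxx [chain_resist (f y) _]chain_resistC.
by lra.
Qed.

Lemma Kirchhoff_numbering (G : graph) (f : G -> 'I_n) : chain_numbering f ->
  Kirchhoff R G = Kirchhoff_base / 2 +
    \sum_(i < h) \sum_(j < h | (i < j)%N) split_weight i j * split_prod i j.
Proof.
move=> f_num; have [f_bij _] := f_num; have rE := resistance_numbering f_num.
have dbl : 2 * Kirchhoff R G = \sum_(x < n) \sum_(y < n) chain_resist x y.
  rewrite (reindex f) /=; last exact: onW_bij.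
  under [RHS]eq_bigr => x _.
    rewrite (reindex f) /=; last exact: onW_bij.
    under eq_bigr do rewrite -rE.
    over.
  rewrite mulr_natl mulr2n {2}/Kirchhoff.
  under [X in _ + X = _]eq_bigr do rewrite big_mkcond /=.
  rewrite exchange_big /= -big_split /=; apply: eq_bigr => x _.
  rewrite [X in X + _]big_mkcond -big_split /=; apply: eq_bigr => y _.
  rewrite [resistance R y x]rE chain_resistC -rE.
  case: ltngtP => [_|_|/val_inj/enum_rank_inj ->]; rewrite ?addr0 ?add0r //.
  by rewrite rE chain_resistxx.
by move: dbl; rewrite sum_chain_resist => dbl; lra.
Qed.

End ChainModel.

(** * Numbering a polycyclic chain along its boundary *)

Section PolyChainNumbering.
Local Open Scope nat_scope.
Variables (k h : nat) (w : chain_weight k h).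
Hypotheses (k_ge4 : 4 <= k) (h_gt0 : 0 < h).

Definition is_end (i : nat) : bool := (i == 0) || (i == h.-1).

(** Edges are counted rather than new vertices, hence the successor. Past the last entry the default
    [ord0] is read, so at every index the lengths are positive and add up to [k - 2] with
    [bot_len]. *)
Definition top_len (i : nat) : nat :=
  (if is_end i then uphalf (k - 4) else nth ord0 w i.-1).+1.

Definition bot_len (i : nat) : nat :=
  (if is_end i then (k - 4)./2 else k - 4 - nth ord0 w i.-1).+1.

Lemma top_bot_len i : top_len i + bot_len i = k - 2.
Proof.
rewrite /top_len /bot_len; case: is_end.
  by have := odd_double_half (k - 4); rewrite uphalf_half; lia.
by have := ltn_ord (nth ord0 w i.-1); lia.
Qed.

Local Notation n := (chain_order (k - 2) h).
Local Notation t := (top_pos top_len).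
Local Notation s := (bot_pos (k - 2) h bot_len).
Local Notation vtx := (subdivision_vertex (quad_vertex h) (chain_subdiv w)).

Let top_gt0 i : 0 < top_len i. Proof. by []. Qed.
Let bot_gt0 i : 0 < bot_len i. Proof. by []. Qed.

(* (b, i, a) stands for the a-th vertex after t_i (b = true) or s_i (b = false) on
   the boundary of the square S_(i+1). The last case of the match is empty. *)
Definition vertex_coord (x : vtx) : bool * nat * nat :=
  match x with
  | inl (b, j) => (b, nat_of_ord j, 0)
  | inr (existT (inl (b, i)) a) => (b, nat_of_ord i, a.+1)
  | inr (existT (inr j) _) => (true, nat_of_ord j, 0)
  end.

Lemma vertex_coord_inj : injective vertex_coord.
Proof.
case=> [[b j]|[[[b j]|j] a]] [[b' j']|[[[b' j']|j'] a']] //=; try by case: a.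
- by case=> -> /val_inj->.
- by case: a'.
- by case=> bb' /val_inj jj' aa'; subst b' j'; rewrite (val_inj aa').
Qed.

Definition coord_pos (c : bool * nat * nat) : nat :=
  if c.1.1 then t c.1.2 + c.2 else s c.1.2 - c.2.

Definition vertex_pos (x : vtx) : nat := coord_pos (vertex_coord x).

Definition coord_ok (c : bool * nat * nat) : bool :=
  (c.1.2 <= h) &&
  (c.2 < if c.1.2 == h then 1 else if c.1.1 then top_len c.1.2 else bot_len c.1.2).

Lemma vertex_coord_ok x : coord_ok (vertex_coord x).
Proof.
rewrite /coord_ok; case: x => [[b j]|[[[b j]|j] [a am]]] //=.
  by rewrite -ltnS ltn_ord /=; case: ifP => // _; case: b.
rewrite ltnW //= ltn_eqF //; move: am => /=.
by rewrite /top_len /bot_len /is_end; case: ifP; case: b.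
Qed.

Lemma top_pos_add_inj i j a b : a < top_len i -> b < top_len j ->
  t i + a = t j + b -> i = j /\ a = b.
Proof.
have lt i' j' a' b' : a' < top_len i' -> i' < j' -> t i' + a' < t j' + b'.
  by move=> ai /(top_pos_le top_gt0); rewrite top_posS; lia.
move=> ai bj E; case: (ltngtP i j) => ij; first by have := lt _ _ a b ai ij; lia.
  by have := lt _ _ b a bj ij; lia.
by rewrite ij in E *; split=> //; lia.
Qed.

Lemma bot_pos_sub_inj i j a b : coord_ok (false, i, a) -> coord_ok (false, j, b) ->
  s i - a = s j - b -> i = j /\ a = b.
Proof.
have lt i' j' a' b' : coord_ok (false, i', a') -> i' < j' -> j' <= h ->
    s j' - b' < s i' - a'.
  rewrite /coord_ok /= => /andP[_ ai] ij jh.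
  have ih := leq_trans ij jh; rewrite ltn_eqF // in ai.
  have := bot_pos_ge h_gt0 bot_gt0 top_bot_len ij jh.
  by rewrite (bot_posS h_gt0 top_bot_len ih); lia.
move=> ai bj E; have ih : i <= h by case/andP: ai.
have jh : j <= h by case/andP: bj.
case: (ltngtP i j) => ij; first by have := lt _ _ a b ai ij jh; lia.
  by have := lt _ _ b a bj ij ih; lia.
split=> //; subst j; move: ai bj; rewrite /coord_ok /= ih /=.
have [_|ih'] := eqVneq i h; first by lia.
have {}ih : i < h by lia.
by have := bot_posS h_gt0 top_bot_len ih; lia.
Qed.

Lemma coord_pos_side c : coord_ok c ->
  if c.1.1 then coord_pos c <= t h else t h < coord_pos c.
Proof.
have ts i := top_lt_bot h_gt0 top_gt0 bot_gt0 top_bot_len (i := h) (j := i) (leqnn h).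
case: c => -[[] j] a; rewrite /coord_ok /coord_pos /= => /andP[jh].
  have [->|jh'] := eqVneq j h; first by lia.
  have {}jh : j < h by lia.
  by have := top_pos_le top_gt0 jh; rewrite top_posS; lia.
have [->|jh'] := eqVneq j h; first by have := ts h (leqnn h); lia.
have {}jh : j < h by lia.
by have := ts _ jh; have := bot_posS h_gt0 top_bot_len jh; lia.
Qed.

Lemma vertex_pos_inj : injective vertex_pos.
Proof.
move=> x y E; apply: vertex_coord_inj; move: E; rewrite /vertex_pos.
move: (vertex_coord_ok x) (vertex_coord_ok y).
case: (vertex_coord x) (vertex_coord y) => -[b i] a [[b' j] a'] x_ok y_ok E.
have bb' : b = b'.
  have := coord_pos_side x_ok; have := coord_pos_side y_ok; rewrite E /=.
  by case: (b); case: (b') => //; lia.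
subst b'; case: b E x_ok y_ok => E x_ok y_ok; last first.
  by have [-> ->] := bot_pos_sub_inj x_ok y_ok E.
have top_ok i' a'' : coord_ok (true, i', a'') -> a'' < top_len i'.
  by rewrite /coord_ok /= => /andP[_]; case: ifP => // _; rewrite ltnS leqn0 => /eqP->.
by have [-> ->] := top_pos_add_inj (top_ok _ _ x_ok) (top_ok _ _ y_ok) E.
Qed.

Lemma vertex_pos_lt x : vertex_pos x < n.
Proof.
rewrite /vertex_pos; have := coord_pos_side (vertex_coord_ok x); rewrite /coord_pos.
case: (_.1.1) => xt.
  apply: leq_ltn_trans xt _.
  exact: (top_pos_lt_order h_gt0 top_gt0 bot_gt0 top_bot_len (leqnn h)).
by have := bot_pos_lt (k - 2) bot_len h_gt0 (vertex_coord x).1.2; lia.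
Qed.

Local Notation pos := (subdivision_pos (@quad_src h) (@quad_tgt h)).

Lemma chain_subdivE b (i : 'I_h) :
  (chain_subdiv w (inl (b, i))).+1 = if b then top_len i else bot_len i.
Proof. by rewrite /= /top_len /bot_len /is_end; case: ifP; case: b. Qed.

Lemma vertex_pos_edge (e : quad_edge h) p : p <= (chain_subdiv w e).+1 ->
  vertex_pos (pos (chain_subdiv w) e p) =
  match e with
  | inl (b, i) => if b then t i + p else s i - p
  | inr j => if p is 0 then t j else s j
  end.
Proof.
case: p => [_|p].
  by case: e => [[[] i]|j]; rewrite /vertex_pos /coord_pos /= ?addn0 ?subn0.
rewrite /subdivision_pos ltnS leq_eqVlt => /orP[/eqP pm|pm]; last first.
  rewrite (insubT (fun q => q < _) pm); by case: e pm => [[b i]|j].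
rewrite insubF ?pm ?ltnn //; case: e pm => [[b i]|j] pm.
  have := chain_subdivE b i; rewrite -pm => pE.
  rewrite /vertex_pos /coord_pos /= /bump /= add1n addn0 subn0 pE.
  case: b {pE pm} => //; first by rewrite top_posS.
  by rewrite (bot_posS h_gt0 top_bot_len (ltn_ord i)) addnK.
by rewrite /vertex_pos /coord_pos /= subn0.
Qed.

(** Locate [z] before [t_h], at [t_h] or on the bottom. The disjunction is due to the bottom edges,
    which the boundary path traverses backwards. *)
Lemma path_edge_lift z : z.+1 < n -> exists e : quad_edge h,
  exists2 p, p <= chain_subdiv w e &
    (vertex_pos (pos (chain_subdiv w) e p) == z) &&
    (vertex_pos (pos (chain_subdiv w) e p.+1) == z.+1) ||
    (vertex_pos (pos (chain_subdiv w) e p) == z.+1) &&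
    (vertex_pos (pos (chain_subdiv w) e p.+1) == z).
Proof.
have topP j : j <= h -> z < t j -> exists2 i, i < h & t i <= z < t i.+1.
  elim: j => [|j IHj] jh; first by rewrite top_pos0.
  by have [/(IHj (ltnW jh))|tz] := ltnP z (t j) => // zt; exists j; rewrite ?tz.
have botP j : j <= h -> s j <= z -> z < s 0 -> exists2 i, i < h & s i.+1 <= z < s i.
  elim: j => [|j IHj] jh; first by lia.
  have [/(IHj (ltnW jh))//|zs sz _] := leqP (s j) z.
  by exists j; rewrite ?zs ?sz.
move=> zn; have sh := bot_posE h_gt0 top_bot_len (leqnn h).
rewrite /chord_len subnn muln0 addn1 in sh.
have [zt|] := ltnP z (t h); last rewrite leq_eqVlt => /orP[/eqP <-|tz].
- have [i ih /andP[tz zt']] := topP h (leqnn h) zt.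
  have E : (chain_subdiv w (inl (true, Ordinal ih))).+1 = top_len i.
    exact: chain_subdivE true (Ordinal ih).
  rewrite top_posS in zt'.
  have pm : z - t i <= chain_subdiv w (inl (true, Ordinal ih)) by rewrite -ltnS E; lia.
  exists (inl (true, Ordinal ih)); exists (z - t i) => //.
  rewrite (vertex_pos_edge (leqW pm)).
  by rewrite (vertex_pos_edge (pm : (z - t i).+1 <= _.+1)) /=; lia.
- exists (inr ord_max); exists 0 => //.
  by rewrite !vertex_pos_edge //= sh addn1 !eqxx.
have z0 : z < s 0 by rewrite bot_pos0; lia.
have [|i ih /andP[sz zs]] := botP h (leqnn h) _ z0; first by rewrite sh addn1.
have E : (chain_subdiv w (inl (false, Ordinal ih))).+1 = bot_len i.
  exact: chain_subdivE false (Ordinal ih).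
have sS := bot_posS h_gt0 top_bot_len ih.
(* On the bottom, offsets run down from [s i], so the edge between [z] and [z.+1] starts at offset
   [s i - z.+1]. *)
have pm : s i - z.+1 <= chain_subdiv w (inl (false, Ordinal ih)) by rewrite -ltnS E; lia.
exists (inl (false, Ordinal ih)); exists (s i - z.+1) => //.
rewrite (vertex_pos_edge (leqW pm)).
by rewrite (vertex_pos_edge (pm : (s i - z.+1).+1 <= _.+1)) /=; lia.
Qed.

Lemma vertex_pos_surj z : z < n -> exists x : vtx, vertex_pos x = z.
Proof.
case: z => [_|z /path_edge_lift[e [p _]]].
  by exists (inl (true, ord0)); rewrite /vertex_pos /coord_pos /= top_pos0.
case/orP=> /andP[/eqP ? /eqP ?].
  by exists (pos (chain_subdiv w) e p.+1).
by exists (pos (chain_subdiv w) e p).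
Qed.

Definition vertex_index (x : poly_chain w) : 'I_n := Ordinal (vertex_pos_lt x).

Lemma vertex_index_bij : bijective vertex_index.
Proof.
have inj : injective vertex_index by move=> x y [] /vertex_pos_inj.
apply: inj_card_bij => //; rewrite -(card_codom inj) subset_leq_card //.
apply/subsetP=> z _; have [x xz] := vertex_pos_surj (ltn_ord z).
by apply/codomP; exists x; apply: val_inj; rewrite /= xz.
Qed.

Lemma poly_chain_numbering : chain_numbering top_len bot_len vertex_index.
Proof.
split; first exact: vertex_index_bij.
move=> x y; apply/existsP/idP => [[e /existsP[[p pm] /= xy]]|].
  have edge_adj : let z := vertex_pos (pos (chain_subdiv w) e p) in
      let z' := vertex_pos (pos (chain_subdiv w) e p.+1) in
      chain_adj (k - 2) h top_len bot_len z z' && chain_adj (k - 2) h top_len bot_len z' z.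
    rewrite /= (vertex_pos_edge (ltnW pm)) (vertex_pos_edge pm) /chain_adj.
    case: e pm {xy} => [[b i]|j] pm.
      rewrite chain_subdivE in pm; case: b pm => pm; first by lia.
      by have := bot_posS h_gt0 top_bot_len (ltn_ord i); lia.
    case: p pm => [_|//].
    (* The rungs [j < h] are chords; the rung [h] is the path edge from [t_h] to [s_h]. *)
    have [jh|hj] := ltnP j h; last first.
      have -> : nat_of_ord j = h by have := ltn_ord j; lia.
      rewrite (bot_posE h_gt0 top_bot_len (leqnn h)) /chord_len; lia.
    apply/andP; split; do 2 (apply/orP; right); apply/existsP; exists (Ordinal jh);
      by rewrite /= !eqxx ?orbT.
  by case/andP: edge_adj => zz' z'z; case/orP: xy => /andP[/eqP-> /eqP->].
have lift e p : p <= chain_subdiv w e ->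
    (x == pos (chain_subdiv w) e p) && (y == pos (chain_subdiv w) e p.+1) ||
    (y == pos (chain_subdiv w) e p) && (x == pos (chain_subdiv w) e p.+1) ->
    exists e, [exists p : 'I_(chain_subdiv w e).+1,
      (x == pos (chain_subdiv w) e p) && (y == pos (chain_subdiv w) e p.+1) ||
      (y == pos (chain_subdiv w) e p) && (x == pos (chain_subdiv w) e p.+1)].
  by move=> pm xy; exists e; apply/existsP; exists (Ordinal (pm : p < _.+1)).
case/or3P => [/eqP yx|/eqP xy|/existsP[j xy]].
- have := ltn_ord (vertex_index y); rewrite yx => /path_edge_lift[e [p pm E]].
  apply: (lift e p pm); rewrite -!(inj_eq vertex_pos_inj).
  by rewrite (yx : vertex_pos y = _) ![_ == vertex_pos (pos _ _ _)]eq_sym.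
- have := ltn_ord (vertex_index x); rewrite xy => /path_edge_lift[e [p pm E]].
  apply: (lift e p pm); rewrite -!(inj_eq vertex_pos_inj).
  by rewrite (xy : vertex_pos x = _) ![_ == vertex_pos (pos _ _ _)]eq_sym orbC.
apply: (lift (inr (widen_ord (leqnSn h) j)) 0) => //.
rewrite -!(inj_eq vertex_pos_inj) !vertex_pos_edge //=.
by move: xy; rewrite /= [(vertex_pos y == _) && _]andbC.
Qed.

End PolyChainNumbering.

(** * Optimal weights *)

Lemma numbering_isomorphic m h u v (G H : graph) (f : G -> 'I_(chain_order m h))
    (g : H -> 'I_(chain_order m h)) :
  chain_numbering u v f -> chain_numbering u v g -> isomorphic G H.
Proof.
move=> [f_bij f_adj] [[g' gK g'K] g_adj]; exists (g' \o f) => [|x y] /=.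
  by apply: bij_comp => //; exists g.
by rewrite g_adj !g'K f_adj.
Qed.

Lemma isomorphic_numbering m h u v (G H : graph) (g : H -> 'I_(chain_order m h)) :
  isomorphic G H -> chain_numbering u v g ->
  exists f : G -> 'I_(chain_order m h), chain_numbering u v f.
Proof.
move=> [f f_bij f_adj] [g_bij g_adj]; exists (g \o f); split=> [|x y].
  exact: bij_comp.
by rewrite -f_adj g_adj.
Qed.

(** * The reflection of the boundary cycle *)

Section Reflection.
Local Open Scope nat_scope.
Variables (m h : nat).
Hypothesis h_gt0 : 0 < h.
Local Notation n := (chain_order m h).

Definition cycle_opp (x : nat) : nat := if x == 0 then 0 else n - x.

Lemma cycle_opp_lt x : cycle_opp x < n.
Proof. by rewrite /cycle_opp /chain_order; case: eqP; lia. Qed.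

Lemma cycle_oppK x : x < n -> cycle_opp (cycle_opp x) = x.
Proof.
move=> xn; rewrite /cycle_opp; case: (eqVneq x 0) => [->//|x0].
by rewrite subn_eq0 leqNgt xn /=; lia.
Qed.

(** For [j > 0] the hypothesis gives [n - t_j = s'_j] and [n - s_j = t'_j], so chord [j] goes to
    chord [j]. Chord 0 closes the path to a cycle; the reflection exchanges it with the first path
    edge. *)
Lemma chain_adj_opp u v u' v' x y :
    (forall i, 0 < u i) -> (forall i, 0 < u' i) ->
    (forall i, u i + v i = m) -> (forall i, u' i + v' i = m) ->
    (forall j, 0 < j < h -> top_pos u j + top_pos u' j = m * j + 1) ->
  x < n -> y < n -> chain_adj m h u v x y ->
  chain_adj m h u' v' (cycle_opp x) (cycle_opp y).
Proof.
move=> u_gt0 u'_gt0 uv uv' opp.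
have path z : z.+1 < n -> chain_adj m h u' v' (cycle_opp z) (cycle_opp z.+1) &&
    chain_adj m h u' v' (cycle_opp z.+1) (cycle_opp z).
  rewrite /chain_adj; case: z => [|z] zn; last by rewrite /cycle_opp /=; lia.
  have [-> ->] : cycle_opp 0 = 0 /\ cycle_opp 1 = n.-1 by rewrite /cycle_opp subn1.
  have ch : is_chord m h u' v' 0 n.-1 && is_chord m h u' v' n.-1 0.
    apply/andP; split; apply/existsP; exists (Ordinal h_gt0);
      by rewrite /= top_pos0 bot_pos0 !eqxx ?orbT.
  by case/andP: ch => -> ->; rewrite !orbT.
have chord j : j < h -> let a := top_pos u j in let b := bot_pos m h v j in
    chain_adj m h u' v' (cycle_opp a) (cycle_opp b) &&
    chain_adj m h u' v' (cycle_opp b) (cycle_opp a).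
  rewrite /= /chain_adj => jh; have [->|j_gt0] := posnP j.
    rewrite top_pos0 bot_pos0.
    have n2 : 2 <= n by rewrite /chain_order; lia.
    have -> : cycle_opp n.-1 = 1 by rewrite /cycle_opp; case: eqP; lia.
    by [].
  have s_eq := bot_posE h_gt0 uv (ltnW jh); have s'_eq := bot_posE h_gt0 uv' (ltnW jh).
  have mh : m * h = m * j + m * (h - j) by rewrite -mulnDr subnKC // ltnW.
  have tt' : top_pos u j + top_pos u' j = m * j + 1 by apply: opp; rewrite j_gt0.
  have t_gt0 : 0 < top_pos u j by rewrite -(top_pos0 u) top_pos_lt.
  have -> : cycle_opp (top_pos u j) = bot_pos m h v' j.
    rewrite /cycle_opp gtn_eqF // s'_eq /chord_len /chain_order {s_eq s'_eq}.
    by move: (m * h) (m * j) (m * (h - j)) mh tt'; lia.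
  have -> : cycle_opp (bot_pos m h v j) = top_pos u' j.
    rewrite /cycle_opp s_eq /chord_len gtn_eqF ?addn1 ?addnS // /chain_order {s_eq s'_eq}.
    by move: (m * h) (m * j) (m * (h - j)) mh tt'; lia.
  have ch : is_chord m h u' v' (top_pos u' j) (bot_pos m h v' j) &&
            is_chord m h u' v' (bot_pos m h v' j) (top_pos u' j).
    apply/andP; split; apply/existsP; exists (Ordinal jh);
      by rewrite /= !eqxx ?orbT.
  by case/andP: ch => -> ->; rewrite !orbT.
move=> xn yn /or3P[/eqP E|/eqP E|/existsP[j]].
- by subst y; case/andP: (path x yn).
- by subst x; case/andP: (path y xn).
by case/orP=> /andP[/eqP-> /eqP->]; case/andP: (chord j (ltn_ord j)).
Qed.

Lemma numbering_opp u v u' v' (G : graph) (f : G -> 'I_n) :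
    (forall i, 0 < u i) -> (forall i, 0 < u' i) ->
    (forall i, u i + v i = m) -> (forall i, u' i + v' i = m) ->
    (forall j, 0 < j < h -> top_pos u j + top_pos u' j = m * j + 1) ->
  chain_numbering u v f ->
  chain_numbering u' v' (fun x => Ordinal (cycle_opp_lt (f x))).
Proof.
move=> u_gt0 u'_gt0 uv uv' opp [f_bij f_adj]; split.
  apply: (bij_comp (f := fun x : 'I_n => Ordinal (cycle_opp_lt x)) _ f_bij).
  by apply: inj_card_bij => // x y [] /(congr1 cycle_opp); rewrite !cycle_oppK // => /val_inj.
move=> x y; rewrite f_adj; apply/idP/idP => /= [|adj'].
  exact: (chain_adj_opp u_gt0 u'_gt0 uv uv' opp).
rewrite -[nat_of_ord (f x)]cycle_oppK // -[nat_of_ord (f y)]cycle_oppK //.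
apply: (chain_adj_opp u'_gt0 u_gt0 uv' uv) adj'; rewrite ?cycle_opp_lt //.
by move=> j /opp; rewrite addnC.
Qed.

End Reflection.

(** * Products of two numbers with a given sum *)

Lemma leq_balanced_prod a b c d : (a + b = c + d -> c <= d + 1 -> d <= c + 1 ->
  a * b <= c * d)%N.
Proof.
move=> E cd dc; have [ac|ca] := leqP a c.
  (* Here [c d - a b = x (d - a)], nonnegative because [d + 1 >= c = a + x]. *)
  have [x cE] : exists x, c = (a + x)%N by exists (c - a)%N; lia.
  have bE : b = (d + x)%N by lia.
  by subst; nia.
have [x aE] : exists x, a = (c + x)%N by exists (a - c)%N; lia.
have dE : d = (b + x)%N by lia.
by subst; nia.
Qed.

Lemma eq_balanced_prod a b c d : (a + b = c + d -> a * b = c * d -> a = c \/ a = d)%N.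
Proof.
move=> E ab; have [ac|ca] := leqP a c.
  have [x cE] : exists x, c = (a + x)%N by exists (c - a)%N; lia.
  have bE : b = (d + x)%N by lia.
  have /eqP : (x * a = x * d)%N by subst; nia.
  by rewrite eqn_mul2l => /orP[/eqP x0|/eqP]; [left; lia|right].
have [x aE] : exists x, a = (c + x)%N by exists (a - c)%N; lia.
have dE : d = (b + x)%N by lia.
have /eqP : (x * b = x * c)%N by subst; nia.
by rewrite eqn_mul2l => /orP[/eqP x0|/eqP bc]; [left|right]; lia.
Qed.

(** * The maximum and the weights attaining it *)

Section Optimum.
Variables (k h : nat).
Hypotheses (k_ge4 : (4 <= k)%N) (h_ge2 : (2 <= h)%N).
Local Notation m := (k - 2)%N.
Local Notation t w := (top_pos (top_len w)).
Local Notation s w := (bot_pos m h (bot_len w)).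
Local Notation fc := (floor_ceil_weight k h).
Local Notation cf := (ceil_floor_weight k h).

Let h_gt0 : (0 < h)%N. Proof. exact: ltnW. Qed.

Lemma top_len_gt0 (w : chain_weight k h) i : (0 < top_len w i)%N. Proof. by []. Qed.

Lemma bot_len_gt0 (w : chain_weight k h) i : (0 < bot_len w i)%N. Proof. by []. Qed.

Lemma top_len_ends (w : chain_weight k h) : top_len w 0 = (uphalf (k - 4)).+1.
Proof. by []. Qed.

Lemma top_len_mid (w : chain_weight k h) i : (0 < i < h.-1)%N ->
  top_len w i = (nth ord0 w i.-1).+1.
Proof. by case/andP=> i0 ih; rewrite /top_len /is_end gtn_eqF // ltn_eqF. Qed.

Lemma top_len_inj (w w' : chain_weight k h) :
  (forall i, (0 < i < h.-1)%N -> top_len w i = top_len w' i) -> w = w'.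
Proof.
move=> ww'; apply: eq_from_tnth => i; have ih := ltn_ord i.
have /ww' : (0 < i.+1 < h.-1)%N by lia.
by rewrite !top_len_mid; [case=> /val_inj; rewrite !(tnth_nth ord0)|lia|lia].
Qed.

Lemma top_len_fc i : (0 < i < h.-1)%N ->
  top_len fc i = (if odd i then (k - 4)./2 else uphalf (k - 4)).+1.
Proof.
move=> ih; rewrite top_len_mid //; case: i ih => // i ih /=.
have ih' : (i < h - 2)%N by lia.
by rewrite (nth_mktuple _ _ (Ordinal ih')) /=; case: odd.
Qed.

Lemma top_len_cf i : (0 < i < h.-1)%N ->
  top_len cf i = (if odd i then uphalf (k - 4) else (k - 4)./2).+1.
Proof.
move=> ih; rewrite top_len_mid //; case: i ih => // i ih /=.
have ih' : (i < h - 2)%N by lia.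
by rewrite (nth_mktuple _ _ (Ordinal ih')) /=; case: odd.
Qed.

Lemma half_uphalf : ((k - 4)./2 + uphalf (k - 4) = k - 4)%N.
Proof. by have := odd_double_half (k - 4); rewrite uphalf_half; lia. Qed.

Lemma uphalf_odd : uphalf (k - 4) = (odd k + (k - 4)./2)%N.
Proof. by rewrite uphalf_half oddB // addbF. Qed.

(** Square 0 has the larger half on top, so weights that begin with the smaller half continue an
    alternation, and [t_j] is always [m j / 2] rounded up. *)
Lemma top_pos_fc j : (j < h)%N -> (2 * t fc j = m * j + (odd k && odd j))%N.
Proof.
have hu := half_uphalf; have uo := uphalf_odd.
elim: j => [|j IHj] jh; first by rewrite top_pos0 andbF; lia.
rewrite top_posS mulnDr IHj ?(ltnW jh) //.
have [->|j_gt0] := posnP j; first by rewrite top_len_ends andbF muln0 muln1; lia.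
by rewrite top_len_fc /=; [case: (odd j); lia|lia].
Qed.

(** Both chains have the larger half on top of square 0, whence the excess 1; afterwards their top
    lengths add up to [m]. This is the condition for the reflection. *)
Lemma top_pos_cf_fc j : odd k -> (0 < j < h)%N -> (t cf j + t fc j = m * j + 1)%N.
Proof.
move=> k_odd; have hu := half_uphalf; have uo := uphalf_odd; rewrite k_odd in uo.
elim: j => // j IHj /andP[_ jh]; rewrite !top_posS.
have [->|j_gt0] := posnP j; first by rewrite !top_len_ends !top_pos0; lia.
have := IHj; rewrite j_gt0 ltnW // => /(_ isT).
by rewrite top_len_fc ?top_len_cf; [case: odd; lia|lia|lia].
Qed.

Lemma split_sum (w : chain_weight k h) i j : (i <= j)%N -> (j < h)%N ->
  ((t w j - t w i) + (s w i - s w j) = m * (j - i))%N.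
Proof.
move=> ij jh; have uv := top_bot_len w k_ge4 h_gt0.
have ih : (i <= h)%N := leq_trans ij (ltnW jh).
have := bot_pos_ge h_gt0 (bot_len_gt0 w) uv ij (ltnW jh).
have := top_pos_le (top_len_gt0 w) ij.
rewrite (bot_posE h_gt0 uv ih) (bot_posE h_gt0 uv (ltnW jh)) /chord_len.
have -> : (m * (h - i) = m * (h - j) + m * (j - i))%N.
  by rewrite -mulnDr; congr (_ * _)%N; lia.
move: (m * (h - j))%N (m * (j - i))%N; lia.
Qed.

(** By [top_pos_fc] each [2 t_j] exceeds [m j] by 0 or 1, so [U - V = 2 U - m (j - i)] is -1, 0 or
    1. *)
Lemma split_fc_balanced i j : (i <= j)%N -> (j < h)%N ->
  let U := (t fc j - t fc i)%N in let V := (s fc i - s fc j)%N in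
  (U <= V + 1)%N && (V <= U + 1)%N.
Proof.
move=> ij jh /=; have := split_sum fc ij jh.
have := top_pos_fc jh; have := top_pos_fc (leq_ltn_trans ij jh).
have := top_pos_le (top_len_gt0 fc) ij.
have -> : (m * j = m * i + m * (j - i))%N by rewrite -mulnDr subnKC.
by move: (m * i)%N (m * (j - i))%N; case: odd; case: (odd i); case: (odd j) => /=; lia.
Qed.

Variable R : realFieldType.
Local Notation splits w := (split_prod R m h (top_len w) (bot_len w)).

Lemma split_prod_le (w : chain_weight k h) i j : (i <= j)%N -> (j < h)%N ->
  splits w i j <= splits fc i j.
Proof.
move=> ij jh; rewrite /split_prod -!natrM ler_nat.
have /andP[UV VU] := split_fc_balanced ij jh.
by apply: leq_balanced_prod => //; rewrite !split_sum.
Qed.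

Lemma split_prod_eq (w : chain_weight k h) i j : (i <= j)%N -> (j < h)%N ->
  splits w i j = splits fc i j ->
  (t w j - t w i = t fc j - t fc i \/ t w j - t w i = s fc i - s fc j)%N.
Proof.
move=> ij jh /eqP; rewrite /split_prod -!natrM eqr_nat => /eqP E.
by apply: eq_balanced_prod E; rewrite !split_sum.
Qed.

Definition Kirchhoff_value (w : chain_weight k h) : R := Kirchhoff_base R m h / 2 +
  \sum_(i < h) \sum_(j < h | (i < j)%N) split_weight R m h i j * splits w i j.

Lemma KirchhoffE (w : chain_weight k h) (G : graph) :
  isomorphic G (poly_chain w) -> Kirchhoff R G = Kirchhoff_value w.
Proof.
have uv := top_bot_len w k_ge4 h_gt0.
move=> /(isomorphic_numbering (g := _))/(_ (poly_chain_numbering w k_ge4 h_gt0))[f f_num].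
exact: (Kirchhoff_numbering R h_gt0 (top_len_gt0 w) (bot_len_gt0 w) uv f_num).
Qed.

Lemma split_weight_ge0 i j : (i < h)%N -> (j < h)%N -> 0 <= split_weight R m h i j.
Proof.
have uv := top_bot_len fc k_ge4 h_gt0.
case: i => [|i] ih jh; first by rewrite /split_weight /shift_coef subrr mul0r mulr0.
exact/ltW/(split_weight_gt0 R h_gt0 (top_len_gt0 fc) uv).
Qed.

Lemma Kirchhoff_value_le w : Kirchhoff_value w <= Kirchhoff_value fc.
Proof.
rewrite lerD2l; apply: ler_sum => i _; apply: ler_sum => j ij.
by rewrite ler_wpM2l ?split_weight_ge0 // split_prod_le // ltnW.
Qed.

(** A sum of nonnegative differences vanishes, hence each of them does. [i = 0] is excluded because
    its weight is zero. *)
Lemma Kirchhoff_value_eq w : Kirchhoff_value w = Kirchhoff_value fc ->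
  forall i j, (0 < i)%N -> (i < j)%N -> (j < h)%N -> splits w i j = splits fc i j.
Proof.
have uv := top_bot_len fc k_ge4 h_gt0.
move=> /addrI E i j i_gt0 ij jh; have ih := ltn_trans ij jh.
pose d (i j : nat) : R := split_weight R m h i j * (splits fc i j - splits w i j).
have d_ge0 (i' j' : 'I_h) : (i' < j')%N -> 0 <= d i' j'.
  by move=> ij'; rewrite mulr_ge0 ?split_weight_ge0 // subr_ge0 split_prod_le // ltnW.
have sum_d : \sum_(i < h) \sum_(j < h | (i < j)%N) d i j = 0.
  rewrite -[RHS](subrr (\sum_(i < h) \sum_(j < h | (i < j)%N)
    split_weight R m h i j * splits fc i j)) -{2}E -sumrB.
  by apply: eq_bigr => i' _; rewrite -sumrB; apply: eq_bigr => j' _; rewrite /d mulrBr.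
have /(_ (Ordinal ih) isT) := psumr_eq0P (fun (i : 'I_h) _ => sumr_ge0 _ (d_ge0 i)) sum_d.
move=> /(psumr_eq0P (d_ge0 (Ordinal ih)))/(_ (Ordinal jh) ij)/eqP.
rewrite mulf_eq0 gt_eqF /=; last first.
  exact: (split_weight_gt0 R h_gt0 (top_len_gt0 fc) uv).
by rewrite subr_eq0 => /eqP.
Qed.

Lemma Kirchhoff_value_eqP w : Kirchhoff_value w = Kirchhoff_value fc ->
  w = fc \/ odd k /\ w = cf.
Proof.
move/Kirchhoff_value_eq => E.
have hu := half_uphalf; have uo := uphalf_odd.
(* The pair [(i, i + 1)]: the top of a single square is one of the two halves. *)
have step i : (0 < i < h.-1)%N -> top_len w i = top_len fc i \/ top_len w i = top_len cf i.
  move=> /andP[i0 ih]; have ih' : (i.+1 < h)%N by lia.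
  have := split_prod_eq (leqnSn i) ih' (E _ _ i0 (ltnSn i) ih').
  have := split_sum fc (leqnSn i) ih'.
  rewrite !top_posS !addKn subSnn muln1 top_len_fc ?i0 // top_len_cf ?i0 //.
  by case: odd; lia.
(* The pair [(i, i + 2)]: [fc] splits two consecutive squares into [m] and [m], so the sum of their
   top lengths is forced. *)
have step2 i : (0 < i)%N -> (i.+1 < h.-1)%N ->
    (top_len w i + top_len w i.+1 = top_len fc i + top_len fc i.+1)%N.
  move=> i0 ih; have ih' : (i.+2 < h)%N by lia.
  have := split_prod_eq (leqW (leqnSn i)) ih' (E _ _ i0 (leqW (ltnSn i)) ih').
  have := split_sum fc (leqW (leqnSn i)) ih'.
  rewrite (_ : i.+2 - i = 2)%N; last by lia.
  rewrite !top_posS -!addnA !addKn top_len_fc ?top_len_fc /=; [|lia|lia].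
  by case: odd => /=; lia.
have fc_cf i : (0 < i < h.-1)%N -> (top_len fc i + top_len cf i = m)%N.
  by move=> ih; rewrite top_len_fc // top_len_cf //; case: odd; lia.
have fc2 i : (0 < i)%N -> (i.+1 < h.-1)%N -> (top_len fc i + top_len fc i.+1 = m)%N.
  by move=> i0 ih; rewrite top_len_fc ?top_len_fc /=; [case: odd => /=; lia|lia|lia].
(* By [step2] each top length determines the next, so all follow from that of square 1. *)
have spread (w' : chain_weight k h) : w' = fc \/ w' = cf ->
    top_len w 1 = top_len w' 1 -> w = w'.
  move=> w'E w1; apply: top_len_inj; elim=> // i IHi /andP[_ ih].
  have [->//|i0] := posnP i.
  have := IHi; rewrite i0 /= => /(_ (ltnW ih)); have := step2 i i0 ih.
  have := fc2 i i0 ih; have := fc_cf i.+1; rewrite ih => /(_ isT).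
  have := fc_cf i; rewrite i0 (ltnW ih) => /(_ isT).
  by case: w'E => ->; lia.
have [h3|h3] := ltnP 1 h.-1; last first.
  by left; apply: top_len_inj => i; lia.
have [/(spread fc)|/(spread cf)] := step 1%N h3; first by move=> ->; [left|left].
move=> wE; rewrite wE; last by right.
(* For even [k] the two halves are equal, so [cf] is [fc]. *)
case: (boolP (odd k)) => k_odd; [by right|left].
apply: top_len_inj => i ih; rewrite top_len_fc // top_len_cf //.
by rewrite uo (negPf k_odd) if_same.
Qed.

Lemma zigzag_ceil_floor : odd k -> isomorphic (zigzag_chain k h) (poly_chain cf).
Proof.
move=> k_odd; have uv w := top_bot_len w k_ge4 h_gt0.
have num w := poly_chain_numbering w k_ge4 h_gt0.
apply: numbering_isomorphic (num fc) _.
apply: (numbering_opp h_gt0 (top_len_gt0 cf) (top_len_gt0 fc) (uv cf) (uv fc) _ (num cf)).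
by move=> j; apply: top_pos_cf_fc.
Qed.

Lemma linear_chainE : ~~ odd k -> linear_chain k h = zigzag_chain k h.
Proof.
move=> k_even; rewrite /linear_chain /zigzag_chain; congr poly_chain.
apply: eq_from_tnth => i; rewrite !tnth_mktuple; case: ifP => // _.
by apply: val_inj; rewrite /= uphalf_odd (negPf k_even).
Qed.

End Optimum.

Lemma isomorphic_refl (G : graph) : isomorphic G G.
Proof. by exists id => //; exists id. Qed.

Lemma isomorphic_sym (G H : graph) : isomorphic G H -> isomorphic H G.
Proof.
move=> [f [g fK gK] f_adj]; exists g; first by exists f.
by move=> x y; rewrite -f_adj !gK.
Qed.

Lemma isomorphic_trans (G H K : graph) :
  isomorphic G H -> isomorphic H K -> isomorphic G K.
Proof.
move=> [f f_bij f_adj] [g g_bij g_adj]; exists (g \o f); first exact: bij_comp.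
by move=> x y; rewrite /= g_adj f_adj.
Qed.

Theorem theorem1p2 (R : realFieldType) (k h : nat)
    (hk : (5 <= k)%N) (hh : (2 <= h)%N) :
  (forall G : graph, polycyclic_chain k h G ->
     Kirchhoff R G <= Kirchhoff R (poly_chain (floor_ceil_weight k h)) /\
     (~~ odd k ->
        (Kirchhoff R G = Kirchhoff R (poly_chain (floor_ceil_weight k h)) <->
         isomorphic G (linear_chain k h))) /\
     (odd k ->
        (Kirchhoff R G = Kirchhoff R (poly_chain (floor_ceil_weight k h)) <->
         isomorphic G (zigzag_chain k h)))) /\
  (odd k -> isomorphic (zigzag_chain k h) (poly_chain (ceil_floor_weight k h))).
Proof.
have k_ge4 : (4 <= k)%N := ltnW hk.
split; last exact: zigzag_ceil_floor.
move=> G [w Gw].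
have K0 := KirchhoffE k_ge4 hh R (isomorphic_refl (poly_chain (floor_ceil_weight k h))).
rewrite (KirchhoffE k_ge4 hh R Gw) K0.
(* One equivalence serves both parities, since for even [k] the linear and the zigzag chain
   coincide. *)
have max_iff : Kirchhoff_value R w = Kirchhoff_value R (floor_ceil_weight k h) <->
    isomorphic G (zigzag_chain k h).
  split=> [/(Kirchhoff_value_eqP k_ge4 hh)[wE|[k_odd wE]]|Gz]; last first.
  - by rewrite -(KirchhoffE k_ge4 hh R Gw) (KirchhoffE k_ge4 hh R Gz).
  - rewrite wE in Gw; apply: isomorphic_trans Gw (isomorphic_sym _).
    exact: zigzag_ceil_floor.
  - by rewrite wE in Gw.
split; first exact: Kirchhoff_value_le.
by split=> // k_even; rewrite linear_chainE.
Qed.
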